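(* Let $w$ be either the empty word or a word in the letters $x_0,x_1$ ending in $x_1$, and let $s\ge3$ be an integer. Then $$\sum_{n=1}^\infty\frac{H_{n-1}(w)}{n^s}\left[4^{-n}\binom{2n}{n}\right]^{-2}\in\mathsf{CMZV}^4_{s+|w|}.$$
   Context: A nonempty word ending in $x_1$ can be written uniquely as $w=x_0^{t_1-1}x_1\cdots x_0^{t_k-1}x_1$ with $t_j$ positive integers; its weight is $|w|=t_1+\cdots+t_k$, and $H_M(w)=\sum_{M\ge m_1>\cdots>m_k\ge1}\frac{1}{m_1^{t_1}\cdots m_k^{t_k}}$ for $M\ge0$ (so $H_0(w)=0$). For the empty word, $|w|=0$ and $H_M(w)=1$. For positive integers $s_1,\dots,s_k$ and complex $a_j$, $L_{s_1,\dots,s_k}(a_1,\dots,a_k)=\sum_{n_1>\cdots>n_k\ge1}\frac{a_1^{n_1}\cdots a_k^{n_k}}{n_1^{s_1}\cdots n_k^{s_k}}$. For integers $N\ge1$, $W\ge1$, $\mathsf{CMZV}^N_W$ is the $\mathbb{Q}$-linear span of all $L_{s_1,\dots,s_k}(a_1,\dots,a_k)$ with $k\ge1$, $s_1+\cdots+s_k=W$, each $a_j$ an $N$-th root of unity, and $(s_1,a_1)\ne(1,1)$. *)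

(* Defs.v *)
From Stdlib Require Import Reals QArith Qreals List Factorial.
From Coquelicot Require Import Coquelicot.
Open Scope R_scope.

(* A word ending in x1 (or empty) w = x0^{t1-1}x1 ... x0^{tk-1}x1 is represented
   by its list of exponents [t1; ...; tk] (all positive); the empty word is [].  *)
Definition word_ok (w : list nat) : Prop := List.Forall (fun t => (0 < t)%nat) w.

Definition weight (w : list nat) : nat := fold_right Nat.add 0%nat w.

(* H_M(w) = sum_{M >= m1 > ... > mk >= 1} 1/(m1^t1 ... mk^tk); H_M([]) = 1. *)
Fixpoint H (M : nat) (w : list nat) {struct M} : R :=
  match w with
  | nil => 1
  | t :: w' =>
    match M with
    | O => 0
    | S M' => H M' w + / (INR M ^ t) * H M' w'
    end
  end.

Definition central_binom (n : nat) : R :=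
  INR (fact (2 * n)) / (INR (fact n) ^ 2).

Definition term (w : list nat) (s n : nat) : R :=
  H (n - 1) w / (INR n ^ s) * / ((/ 4 ^ n * central_binom n) ^ 2).

Fixpoint Cpow (a : C) (n : nat) : C :=
  match n with
  | O => RtoC 1
  | S n' => Cmult a (Cpow a n')
  end.

(* Partial sums of the multiple polylogarithm over N >= n1 > ... > nk >= 1,
   for data [(s1,a1); ...; (sk,ak)]. *)
Fixpoint Lpart (N : nat) (d : list (nat * C)) {struct N} : C :=
  match d with
  | nil => RtoC 1
  | (s, a) :: d' =>
    match N with
    | O => RtoC 0
    | S N' => Cplus (Lpart N' d)
                    (Cmult (Cmult (Cpow a N) (Cinv (RtoC (INR N ^ s)))) (Lpart N' d'))
    end
  end.

Definition is_L (d : list (nat * C)) (v : C) : Prop :=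
  filterlim (fun N => Lpart N d) eventually (locally v).

Definition admissible (N W : nat) (d : list (nat * C)) : Prop :=
  match d with
  | nil => False
  | (s1, a1) :: _ =>
      (s1 <> 1%nat \/ a1 <> RtoC 1) /\
      List.Forall (fun p => (0 < fst p)%nat /\ Cpow (snd p) N = RtoC 1) d /\
      fold_right Nat.add 0%nat (map fst d) = W
  end.

Definition in_CMZV (N W : nat) (z : C) : Prop :=
  exists l : list (Q * list (nat * C) * C),
    List.Forall (fun x => admissible N W (snd (fst x)) /\ is_L (snd (fst x)) (snd x)) l /\
    z = fold_right (fun x acc => Cplus (Cmult (RtoC (Q2R (fst (fst x)))) (snd x)) acc)
                   (RtoC 0) l.

(* Main.v *)
(** Write [b_n = 4^-n binom(2n,n)] and let [G_(w,s)(theta)] be the sum over [n] of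
    [H_(n-1)(w) sin^(2n) theta / (n^s b_n)].  Since [1 / (n b_n)] is twice the
    integral of [sin^(2n-1)] over [[0, pi/2]], the series of the theorem is
    [2 int_0^(pi/2) G_(w,s-1) dtheta / sin theta].

    [d G_(w,s+1) = 2 cot theta G_(w,s) dtheta], and the two-term recurrence for [b_n]
    gives [d (cot theta G_(t w',1)) = 2 G_(w',t) dtheta], starting from
    [cot theta G_(nil,1) = 2 theta].  So [G_(w,s)], for [s >= 2], is an iterated
    integral in [dtheta], [cot theta dtheta] and [tan theta dtheta].  Under
    [t = tan (theta/2)] these become combinations of [dt/t] and
    [eta dt / (1 - eta t)] with [eta^4 = 1], while [dtheta / sin theta = dt/t].
    The coefficients are rational except for a factor [i] per [dtheta], and [dtheta]
    occurs an even number of times.  As the outermost form is [dt/t], only absolutely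
    convergent L-values, with first exponent at least [2], occur. *)
Require Import Defs.
From Stdlib Require Import Reals QArith Qreals List Lra Lia.
From Coquelicot Require Import Coquelicot.
Open Scope R_scope.

(** * Real series and primitives *)

Lemma INR_S_ge_1 (n : nat) : 1 <= INR (S n).
Proof. rewrite S_INR. pose proof (pos_INR n). lra. Qed.

Lemma is_derive_continuity_pt (f : R -> R) (x l : R) :
  is_derive f x l -> continuity_pt f x.
Proof.
  intros Hf. apply continuity_pt_filterlim.
  apply (ex_derive_continuous f). now exists l.
Qed.

Lemma le_of_derive_nonneg (f f' : R -> R) (a b : R) :
  a <= b -> (forall x, a <= x <= b -> is_derive f x (f' x)) ->
  (forall x, a <= x <= b -> 0 <= f' x) -> f a <= f b.
Proof.
  intros Hab Hder Hpos.
  destruct (MVT_gen f a b f') as (c & Hc & Hmvt);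
    rewrite ?Rmin_left, ?Rmax_right in * by lra.
  - intros x Hx. apply Hder; lra.
  - intros x Hx. eapply is_derive_continuity_pt, Hder, Hx.
  - specialize (Hpos c Hc). nra.
Qed.

Lemma is_lim_seq_of_derive (f f' : nat -> R -> R) (g g' : R -> R)
    (err : nat -> R) (a b : R) :
  a <= b -> (forall n, f n a = g a) ->
  (forall n x, a <= x <= b -> continuity_pt (f n) x) ->
  (forall x, a <= x <= b -> continuity_pt g x) ->
  (forall n x, a < x < b -> is_derive (f n) x (f' n x)) ->
  (forall x, a < x < b -> is_derive g x (g' x)) ->
  (forall n x, a <= x <= b -> Rabs (f' n x - g' x) <= err n) ->
  is_lim_seq err 0 -> is_lim_seq (fun n => f n b) (g b).
Proof.
  intros Hab Ha Hcf Hcg Hdf Hdg Herr Hlim.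
  assert (Hdist : forall n, Rabs (f n b - g b) <= err n * (b - a)).
  { intros n.
    destruct (MVT_gen (fun x => f n x - g x) a b (fun x => f' n x - g' x))
      as (c & Hc & Hmvt); rewrite ?Rmin_left, ?Rmax_right in * by lra.
    - intros x Hx. apply (is_derive_minus (V := R_NormedModule)); auto.
    - intros x Hx. apply continuity_pt_minus; auto.
    - replace (f n b - g b) with ((f' n c - g' c) * (b - a))
        by (rewrite <- Hmvt, Ha; ring).
      rewrite Rabs_mult, (Rabs_pos_eq (b - a)) by lra.
      apply Rmult_le_compat_r; [lra|auto]. }
  assert (Hbound : is_lim_seq (fun n => err n * (b - a)) 0).
  { replace (Finite 0) with (Rbar_mult 0 (b - a)) by (simpl; f_equal; ring).
    now apply is_lim_seq_scal_r. }
  assert (Hdiff : is_lim_seq (fun n => f n b - g b) 0).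
  { apply is_lim_seq_abs_0.
    apply is_lim_seq_le_le with (fun _ => 0) (fun n => err n * (b - a));
      [|apply is_lim_seq_const|exact Hbound].
    intros n. split; [apply Rabs_pos|apply Hdist]. }
  apply is_lim_seq_ext with (fun n => g b + (f n b - g b)); [intros n; ring|].
  replace (Finite (g b)) with (Finite (g b + 0)) by (f_equal; ring).
  apply is_lim_seq_plus'; [apply is_lim_seq_const|exact Hdiff].
Qed.

Lemma sum_n_le_sum_n_S (u : nat -> R) (n : nat) :
  0 <= u (S n) -> sum_n u n <= sum_n u (S n).
Proof. intros Hu. rewrite sum_Sn. unfold plus; simpl. lra. Qed.

Lemma is_series_zero {K : AbsRing} {V : NormedModule K} (a : nat -> V) :
  (forall n, a n = zero) -> is_series a zero.
Proof.
  intros Ha. unfold is_series. eapply filterlim_ext; [|apply filterlim_const].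
  intros n. induction n as [|n IH]; [now rewrite sum_O, Ha|].
  now rewrite sum_Sn, <- IH, Ha, plus_zero_r.
Qed.

Lemma ex_series_telescope (u c : nat -> R) :
  (forall n, 0 <= u n <= c n - c (S n)) -> (forall n, 0 <= c n) -> ex_series u.
Proof.
  intros Hu Hc.
  assert (Hsum : forall n, sum_n u n <= c O - c (S n)).
  { induction n as [|n IH]; [rewrite sum_O; apply Hu|].
    rewrite sum_Sn. unfold plus; simpl. specialize (Hu (S n)). lra. }
  destruct (ex_finite_lim_seq_incr (sum_n u) (c O)) as [l Hl].
  - intros n. apply sum_n_le_sum_n_S, Hu.
  - intros n. specialize (Hsum n). specialize (Hc (S n)). lra.
  - now exists l.
Qed.

Lemma continuous_sum_n {U : UniformSpace} {K : AbsRing} {V : NormedModule K}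
    (h : nat -> U -> V) (x : U) (n : nat) :
  (forall m, continuous (h m) x) -> continuous (fun y => sum_n (fun m => h m y) n) x.
Proof.
  intros Hh. induction n as [|n IH].
  - apply (continuous_ext (h O)); [|apply Hh]. intros y. now rewrite sum_O.
  - apply (continuous_ext (fun y => plus (sum_n (fun m => h m y) n) (h (S n) y))).
    + intros y. now rewrite sum_Sn.
    + apply continuous_plus; [exact IH|apply Hh].
Qed.

Lemma at_left_interval (a b : R) : a < b -> at_left b (fun x => a < x < b).
Proof.
  intros Hab. exists (mkposreal (b - a) ltac:(lra)). intros x Hx Hlt.
  unfold ball in Hx; simpl in Hx. unfold AbsRing_ball, abs, minus, plus, opp in Hx.
  simpl in Hx. apply Rabs_def2 in Hx. lra.
Qed.

(* Monotone convergence as an exchange of two suprema: both sides are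
   [sup_(N, x) sum_(m <= N) h m x]. *)
Lemma is_series_at_left (h : nat -> R -> R) (B : R -> R) (a b l : R) :
  a < b ->
  (forall m x, a < x < b -> 0 <= h m x <= h m b) ->
  (forall m, continuous (h m) b) ->
  (forall x, a < x < b -> is_series (fun m => h m x) (B x)) ->
  filterlim B (at_left b) (locally l) -> is_series (fun m => h m b) l.
Proof.
  intros Hab Hmono Hcont Hser Hlim.
  assert (Hleft := at_left_interval a b Hab).
  assert (Hpos : forall m, 0 <= h m b).
  { intros m. specialize (Hmono m ((a + b) / 2)). lra. }
  assert (Hle : forall N, sum_n (fun m => h m b) N <= l).
  { intros N.
    apply (filterlim_le (F := at_left b)
      (fun x => sum_n (fun m => h m x) N) B (sum_n (fun m => h m b) N) l);
      [| |exact Hlim].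
    - eapply filter_imp; [|exact Hleft]. intros x Hx.
      apply (is_lim_seq_incr_compare _ _ (Hser x Hx)).
      intros n. now apply sum_n_le_sum_n_S, Hmono.
    - eapply filterlim_filter_le_1; [apply filter_le_within|].
      now apply (continuous_sum_n h b N). }
  destruct (ex_finite_lim_seq_incr (sum_n (fun m => h m b)) l) as [L HL];
    [intros n; now apply sum_n_le_sum_n_S|exact Hle|].
  assert (HLl : L <= l) by exact (is_lim_seq_le _ _ L l Hle HL (is_lim_seq_const l)).
  assert (HlL : l <= L).
  { apply (filterlim_le (F := at_left b) B (fun _ => L) l L);
      [|exact Hlim|apply filterlim_const].
    eapply filter_imp; [|exact Hleft]. intros x Hx.
    refine (is_lim_seq_le _ _ (B x) L _ (Hser x Hx) HL).
    intros n. apply sum_n_m_le. intros m. now apply Hmono. }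
  replace l with L by lra. exact HL.
Qed.

Lemma Rabs_lt_CV_radius (a : nat -> R) (x : R) :
  Rbar_le 1 (CV_radius a) -> Rabs x < 1 -> Rbar_lt (Rabs x) (CV_radius a).
Proof. intros Ha Hx. now apply Rbar_lt_le_trans with 1. Qed.

Lemma CV_radius_ge_1_bounded (a : nat -> R) (M : R) :
  (forall n, Rabs (a n) <= M) -> Rbar_le 1 (CV_radius a).
Proof.
  intros Ha. apply (proj1 (CV_radius_bounded a)). exists M. intros n.
  rewrite pow1, Rmult_1_r. apply Ha.
Qed.

Lemma CV_radius_ge_1_linear (a : nat -> R) (M : R) :
  (forall n, Rabs (a n) <= M * INR (S n)) -> Rbar_le 1 (CV_radius a).
Proof.
  intros Ha. rewrite <- CV_radius_Int.
  assert (HM : 0 <= M).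
  { specialize (Ha O). pose proof (Rabs_pos (a O)). simpl in Ha. lra. }
  apply CV_radius_ge_1_bounded with M. intros [|n].
  - simpl. now rewrite Rabs_R0.
  - assert (Hn : 0 < INR (S n)) by (apply lt_0_INR; lia).
    cbn [PS_Int]. rewrite Rabs_div, (Rabs_pos_eq (INR _)) by lra.
    apply Rle_div_l; [exact Hn|apply Ha].
Qed.

Lemma ex_pseries_unit_disk (a : nat -> R) (x : R) :
  Rbar_le 1 (CV_radius a) -> Rabs x < 1 -> ex_pseries a x.
Proof. intros Ha Hx. now apply CV_radius_inside, Rabs_lt_CV_radius. Qed.

Definition PS_one (n : nat) : R := match n with O => 1 | S _ => 0 end.

Lemma CV_radius_PS_one : Rbar_le 1 (CV_radius PS_one).
Proof.
  apply CV_radius_ge_1_bounded with 1.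
  intros [|n]; simpl; rewrite ?Rabs_R1, ?Rabs_R0; lra.
Qed.

Lemma PSeries_PS_one (x : R) : Rabs x < 1 -> PSeries PS_one x = 1.
Proof.
  intros Hx. rewrite PSeries_decr_1
    by (apply ex_pseries_unit_disk; [exact CV_radius_PS_one|exact Hx]).
  rewrite (PSeries_ext (PS_decr_1 PS_one) (fun _ => 0)) by reflexivity.
  rewrite PSeries_const_0. simpl; ring.
Qed.

Lemma PSeries_mult_unit_disk (a b : nat -> R) (t : R) :
  Rbar_le 1 (CV_radius a) -> Rbar_le 1 (CV_radius b) -> Rabs t < 1 ->
  PSeries (PS_mult a b) t = PSeries a t * PSeries b t.
Proof. intros Ha Hb Ht. now apply PSeries_mult; apply Rabs_lt_CV_radius. Qed.

Lemma PSeries_decr_1_div (a : nat -> R) (t : R) :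
  a O = 0 -> t <> 0 -> PSeries (PS_decr_1 a) t = PSeries a t / t.
Proof. intros Ha Ht. rewrite (PSeries_decr_1_aux a t Ha). field. exact Ht. Qed.

Lemma PSeries_tail_le (u : nat -> R) (x r : R) (N : nat) :
  (forall n, 0 <= u n) -> Rbar_lt r (CV_radius u) -> 0 <= x <= r ->
  0 <= PSeries u x - sum_n (fun n => u n * x ^ n) N
    <= PSeries u r - sum_n (fun n => u n * r ^ n) N.
Proof.
  intros Hu Hr Hx.
  set (tail := fun (y : R) (k : nat) => u (S N + k)%nat * y ^ (S N + k)).
  assert (Hex : forall y, 0 <= y <= r -> ex_series (fun n => u n * y ^ n)).
  { intros y Hy. apply ex_series_Rabs, CV_disk_inside.
    rewrite Rabs_pos_eq by lra. now apply Rbar_le_lt_trans with r. }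
  assert (Htail : forall y, 0 <= y <= r ->
    PSeries u y - sum_n (fun n => u n * y ^ n) N = Series (tail y)).
  { intros y Hy. unfold PSeries.
    rewrite (Series_incr_n _ (S N)), sum_n_Reals by (auto; lia).
    unfold tail; simpl; ring. }
  rewrite !Htail by lra.
  assert (Hpos : forall y k, 0 <= y -> 0 <= tail y k).
  { intros y k Hy. apply Rmult_le_pos; [apply Hu|now apply pow_le]. }
  split.
  - rewrite <- (Rmult_0_l (Series (tail x))), <- Series_scal_l. apply Series_le.
    + intros k. assert (0 <= tail x k) by (apply Hpos; lra). lra.
    + apply (ex_series_incr_n (fun n => u n * x ^ n) (S N)), Hex; lra.
  - apply Series_le.
    + intros k. split; [apply Hpos; lra|].
      apply Rmult_le_compat_l; [apply Hu|apply pow_incr; lra].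
    + apply (ex_series_incr_n (fun n => u n * r ^ n) (S N)), Hex; lra.
Qed.

Lemma is_lim_seq_PSeries_tail (u : nat -> R) (x : R) :
  Rbar_lt (Rabs x) (CV_radius u) ->
  is_lim_seq (fun N => PSeries u x - sum_n (fun n => u n * x ^ n) N) 0.
Proof.
  intros Hx. replace (Finite 0) with (Finite (PSeries u x - PSeries u x))
    by (f_equal; ring).
  apply is_lim_seq_minus'; [apply is_lim_seq_const|].
  eapply is_lim_seq_ext; [|exact (PSeries_correct _ _ (CV_radius_inside _ _ Hx))].
  intros N. apply sum_n_ext. intros n. unfold scal; simpl. unfold mult; simpl.
  rewrite pow_n_pow. apply Rmult_comm.
Qed.

Lemma PSeries_at_left_1 (a : nat -> R) (l : R) :
  Rbar_le 1 (CV_radius a) -> is_series a l ->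
  filterlim (PSeries a) (at_left 1) (locally l).
Proof.
  intros Ha Hl.
  assert (Hp : is_pseries a 1 l).
  { eapply is_series_ext; [|exact Hl]. intros n. unfold scal; simpl.
    unfold mult; simpl. rewrite pow_n_pow, pow1. ring. }
  rewrite <- (is_pseries_unique _ _ _ Hp).
  destruct (Rbar_le_lt_or_eq_dec _ _ Ha) as [Hlt|Heq].
  - eapply filterlim_filter_le_1; [apply filter_le_within|].
    apply continuity_pt_filterlim, PSeries_continuity. now rewrite Rabs_R1.
  - pose proof (Abel a) as Habel. rewrite <- Heq in Habel.
    apply Habel; [simpl; lra|exact I|now exists l].
Qed.

(* [f] may be singular at [0], so it is the derivative of [F] only on [(0, 1)]. *)
Definition is_primitive (F f : R -> R) : Prop :=
  F 0 = 0 /\ (forall t, 0 <= t < 1 -> continuity_pt F t) /\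
  (forall t, 0 < t < 1 -> is_derive F t (f t)).

Lemma is_primitive_ext (F f g : R -> R) :
  (forall t, 0 < t < 1 -> f t = g t) -> is_primitive F f -> is_primitive F g.
Proof.
  intros Hfg (H0 & Hcont & Hder). split; [exact H0|]. split; [exact Hcont|].
  intros t Ht. rewrite <- Hfg by exact Ht. now apply Hder.
Qed.

Lemma is_primitive_of_derive (F f : R -> R) :
  F 0 = 0 -> (forall t, 0 <= t < 1 -> is_derive F t (f t)) -> is_primitive F f.
Proof.
  intros H0 Hder. split; [exact H0|]. split.
  - intros t Ht. now apply is_derive_continuity_pt with (f t), Hder.
  - intros t Ht. apply Hder; lra.
Qed.

Lemma is_primitive_unique (F G f : R -> R) (t : R) :
  is_primitive F f -> is_primitive G f -> 0 <= t < 1 -> F t = G t.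
Proof.
  intros (HF0 & HFc & HFd) (HG0 & HGc & HGd) Ht.
  destruct (MVT_gen (fun x => F x - G x) 0 t (fun _ => 0)) as (c & _ & Hmvt);
    rewrite ?Rmin_left, ?Rmax_right by lra.
  - intros x Hx. replace 0 with (minus (f x) (f x)) by exact (minus_eq_zero (f x)).
    apply (is_derive_minus (V := R_NormedModule)); [apply HFd|apply HGd]; lra.
  - intros x Hx. apply continuity_pt_minus; [apply HFc|apply HGc]; lra.
  - rewrite HF0, HG0 in Hmvt. lra.
Qed.

Lemma PS_incr_1_derive (a : nat -> R) (n : nat) :
  PS_incr_1 (PS_derive a) n = INR n * a n.
Proof. destruct n as [|n]; [symmetry; exact (Rmult_0_l _)|reflexivity]. Qed.

Lemma PS_derive_Int (a : nat -> R) (n : nat) : PS_derive (PS_Int a) n = a n.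
Proof. unfold PS_derive, PS_Int. field. now apply not_0_INR. Qed.

Lemma PS_Int_plus (a b : nat -> R) (n : nat) :
  PS_Int (PS_plus a b) n = PS_plus (PS_Int a) (PS_Int b) n.
Proof.
  unfold PS_plus, plus; simpl. destruct n as [|n]; cbn [PS_Int]; [ring|].
  unfold Rdiv. ring.
Qed.

Lemma is_primitive_PS_Int (a : nat -> R) :
  Rbar_le 1 (CV_radius a) -> is_primitive (PSeries (PS_Int a)) (PSeries a).
Proof.
  intros Ha. apply is_primitive_of_derive; [apply PSeries_0|].
  intros t Ht. rewrite <- (PSeries_ext _ _ t (PS_derive_Int a)).
  apply is_derive_PSeries, Rabs_lt_CV_radius;
    [now rewrite CV_radius_Int|rewrite Rabs_pos_eq; lra].
Qed.

(** * Rational spans of sequences *)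

Lemma Q2R_integer (z : Z) : Q2R (z # 1) = IZR z.
Proof. unfold Q2R. simpl. field. Qed.

Inductive Qspan (G : (nat -> C) -> Prop) : (nat -> C) -> Prop :=
| Qspan_zero (z : nat -> C) : (forall n, z n = RtoC 0) -> Qspan G z
| Qspan_cons (q : Q) (g z z' : nat -> C) :
    G g -> Qspan G z -> (forall n, z' n = (RtoC (Q2R q) * g n + z n)%C) ->
    Qspan G z'.

Lemma Qspan_ext (G : (nat -> C) -> Prop) (z z' : nat -> C) :
  (forall n, z n = z' n) -> Qspan G z -> Qspan G z'.
Proof.
  intros Heq Hz. destruct Hz as [z Hz|q g z1 z Hg Hz1 Hz].
  - apply Qspan_zero. intros n. now rewrite <- Heq.
  - apply (Qspan_cons _ q g z1); auto. intros n. now rewrite <- Heq.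
Qed.

Lemma Qspan_lincomb (G : (nat -> C) -> Prop) (q : Q) (x y : nat -> C) :
  Qspan G x -> Qspan G y -> Qspan G (fun n => RtoC (Q2R q) * x n + y n)%C.
Proof.
  intros Hx Hy. induction Hx as [x Hx|r g x x' Hg Hx IH Hx'].
  - apply Qspan_ext with y; [|exact Hy]. intros n. rewrite Hx. ring.
  - apply (Qspan_cons _ (q * r)%Q g _ _ Hg IH). intros n.
    rewrite Hx', Q2R_mult, RtoC_mult. ring.
Qed.

Lemma Qspan_scal (G : (nat -> C) -> Prop) (q : Q) (x : nat -> C) :
  Qspan G x -> Qspan G (fun n => RtoC (Q2R q) * x n)%C.
Proof.
  intros Hx. eapply Qspan_ext;
    [|apply (Qspan_lincomb _ q x (fun _ => RtoC 0) Hx); now apply Qspan_zero].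
  intros n. cbv beta. ring.
Qed.

Lemma Qspan_plus (G : (nat -> C) -> Prop) (x y : nat -> C) :
  Qspan G x -> Qspan G y -> Qspan G (fun n => x n + y n)%C.
Proof.
  intros Hx Hy. eapply Qspan_ext; [|exact (Qspan_lincomb _ 1%Q _ _ Hx Hy)].
  intros n. cbv beta. rewrite Q2R_integer. ring.
Qed.

Lemma Qspan_gen (G : (nat -> C) -> Prop) (z : nat -> C) : G z -> Qspan G z.
Proof.
  intros Hz.
  apply (Qspan_cons _ 1%Q z (fun _ => RtoC 0)); [exact Hz|now apply Qspan_zero|].
  intros n. rewrite Q2R_integer. ring.
Qed.

Lemma Qspan_bounded (G : (nat -> C) -> Prop) (B : R) (z : nat -> C) :
  (forall g, G g -> forall n, Cmod (g n) <= B) -> Qspan G z ->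
  exists M, forall n, Cmod (z n) <= M.
Proof.
  intros HG Hz. induction Hz as [z Hz|q g z z' Hg _ [M HM] Hz'].
  - exists 0. intros n. rewrite Hz, Cmod_0. lra.
  - exists (Rabs (Q2R q) * B + M). intros n. rewrite Hz'.
    eapply Rle_trans; [apply Cmod_triangle|].
    apply Rplus_le_compat; [|apply HM]. rewrite Cmod_mult, Cmod_R.
    apply Rmult_le_compat_l; [apply Rabs_pos|now apply HG].
Qed.

Definition Qlinear (T : (nat -> C) -> nat -> C) : Prop :=
  forall (q : Q) (x y z : nat -> C),
    (forall n, z n = (RtoC (Q2R q) * x n + y n)%C) ->
    forall n, T z n = (RtoC (Q2R q) * T x n + T y n)%C.

Lemma Qlinear_zero (T : (nat -> C) -> nat -> C) (z : nat -> C) (n : nat) :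
  Qlinear T -> (forall m, z m = RtoC 0) -> T z n = RtoC 0.
Proof.
  intros HT Hz. rewrite (HT (-1)%Q z z z).
  - rewrite Q2R_integer. change (-1) with (Ropp 1). rewrite RtoC_opp. ring.
  - intros m. rewrite Hz. ring.
Qed.

Lemma Qspan_map (G G' : (nat -> C) -> Prop) (T : (nat -> C) -> nat -> C)
    (z : nat -> C) :
  Qlinear T -> (forall g, G g -> Qspan G' (T g)) -> Qspan G z -> Qspan G' (T z).
Proof.
  intros HT HG Hz. induction Hz as [z Hz|q g z z' Hg Hz IH Hz'].
  - apply Qspan_zero. intros n. now apply Qlinear_zero.
  - apply Qspan_ext with (2 := Qspan_lincomb _ q _ _ (HG g Hg) IH).
    intros n. symmetry. now apply HT.
Qed.

Definition CPS_decr_1 (z : nat -> C) (n : nat) : C := z (S n).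

Definition CPS_Int (z : nat -> C) (n : nat) : C :=
  match n with
  | O => RtoC 0
  | S m => (z m / RtoC (INR n))%C
  end.

Definition CPS_mult (x y : nat -> C) (n : nat) : C :=
  sum_n (fun k => (x k * y (n - k)%nat)%C) n.

Lemma Qlinear_comp (T U : (nat -> C) -> nat -> C) :
  Qlinear T -> Qlinear U -> Qlinear (fun z => T (U z)).
Proof. intros HT HU q x y z Hz. now apply HT, HU. Qed.

Lemma Qlinear_decr_1 : Qlinear CPS_decr_1.
Proof. intros q x y z Hz n. apply Hz. Qed.

Lemma Qlinear_Int : Qlinear CPS_Int.
Proof.
  intros q x y z Hz [|n]; cbn [CPS_Int]; [ring|].
  rewrite Hz. unfold Cdiv. ring.
Qed.

Lemma Qlinear_mult_l (y : nat -> C) : Qlinear (fun x => CPS_mult x y).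
Proof.
  intros q x1 x2 x Hx n. unfold CPS_mult.
  rewrite <- (sum_n_mult_l (K := C_Ring)), <- (sum_n_plus (G := C_AbelianMonoid)).
  apply sum_n_ext. intros k. rewrite Hx. unfold plus, mult; simpl. ring.
Qed.

Lemma Qlinear_mult_r (x : nat -> C) : Qlinear (CPS_mult x).
Proof.
  intros q y1 y2 y Hy n. unfold CPS_mult.
  rewrite <- (sum_n_mult_l (K := C_Ring)), <- (sum_n_plus (G := C_AbelianMonoid)).
  apply sum_n_ext. intros k. rewrite Hy. unfold plus, mult; simpl. ring.
Qed.

Lemma sum_n_RtoC (a : nat -> R) (n : nat) :
  sum_n (G := C_AbelianMonoid) (fun k => RtoC (a k)) n = RtoC (sum_n a n).
Proof.
  induction n as [|n IH]; [now rewrite !sum_O|].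
  rewrite !sum_Sn, IH. symmetry. apply RtoC_plus.
Qed.

Lemma is_series_RtoC (a : nat -> R) (v : C) :
  is_series (V := C_NormedModule) (fun n => RtoC (a n)) v ->
  exists l, v = RtoC l /\ is_series a l.
Proof.
  destruct v as [x y]. intros Hv. exists x.
  assert (Hsum : filterlim (fun n => RtoC (sum_n a n)) eventually (locally (x, y))).
  { eapply filterlim_ext; [|exact Hv]. intros n. apply sum_n_RtoC. }
  assert (Hre : is_lim_seq (sum_n a) x).
  { apply (filterlim_comp _ _ _ (fun n => RtoC (sum_n a n)) fst _ (locally (x, y)));
      [exact Hsum|apply continuous_fst]. }
  assert (Him : is_lim_seq (fun _ => 0) y).
  { apply (filterlim_comp _ _ _ (fun n => RtoC (sum_n a n)) snd _ (locally (x, y)));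
      [exact Hsum|apply continuous_snd]. }
  split; [|exact Hre].
  apply is_lim_seq_unique in Him. rewrite Lim_seq_const in Him.
  now injection Him as <-.
Qed.

(* The real sequences [a] below lie in rational spans only up to a power of [i],
   of which only the parity [e] matters. *)
Definition Ci_power (e : bool) : C := if e then Ci else RtoC 1.

Definition twist (e : bool) (a : nat -> R) (n : nat) : C :=
  (RtoC (a n) * Ci_power e)%C.

Lemma Ci_sqr : (Ci * Ci)%C = RtoC (-1).
Proof. unfold Ci, Cmult, RtoC; simpl. f_equal; ring. Qed.

Lemma Cmod_twist (e : bool) (a : nat -> R) (n : nat) : Cmod (twist e a n) = Rabs (a n).
Proof.
  unfold twist. rewrite Cmod_mult, Cmod_R.
  replace (Cmod (Ci_power e)) with 1; [ring|].
  symmetry. destruct e; [apply Cmod_Ci|apply Cmod_1].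
Qed.

Lemma twist_plus (e : bool) (a b : nat -> R) (n : nat) :
  twist e (PS_plus a b) n = (twist e a n + twist e b n)%C.
Proof.
  unfold twist. change (PS_plus a b n) with (a n + b n). rewrite RtoC_plus. ring.
Qed.

Lemma twist_scal (e : bool) (c : R) (a : nat -> R) (n : nat) :
  twist e (PS_scal c a) n = (RtoC c * twist e a n)%C.
Proof.
  unfold twist. change (PS_scal c a n) with (c * a n). rewrite RtoC_mult. ring.
Qed.

Lemma CPS_Int_twist (e : bool) (a : nat -> R) (n : nat) :
  CPS_Int (twist e a) n = twist e (PS_Int a) n.
Proof.
  unfold twist. destruct n as [|n]; cbn [CPS_Int PS_Int]; [ring|].
  unfold Rdiv, Cdiv. rewrite RtoC_mult, RtoC_inv by now apply not_0_INR. ring.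
Qed.

Lemma CPS_mult_twist (e e' : bool) (a b : nat -> R) (n : nat) :
  twist (xorb e e') (PS_mult a b) n
  = (RtoC (Q2R (if e && e' then -1 else 1)) * CPS_mult (twist e a) (twist e' b) n)%C.
Proof.
  assert (Hsum : CPS_mult (twist e a) (twist e' b) n
    = (Ci_power e * Ci_power e' * RtoC (PS_mult a b n))%C).
  { unfold CPS_mult, PS_mult. rewrite <- sum_n_Reals, <- sum_n_RtoC.
    rewrite <- (sum_n_mult_l (K := C_Ring) (Ci_power e * Ci_power e')%C).
    apply sum_n_ext. intros k.
    change (twist e a k * twist e' b (n - k)%nat
      = Ci_power e * Ci_power e' * RtoC (a k * b (n - k)%nat))%C.
    unfold twist. rewrite RtoC_mult. ring. }
  rewrite Hsum. unfold twist.
  destruct e, e'; cbn [andb xorb Ci_power]; rewrite Q2R_integer; try ring.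
  rewrite Ci_sqr. replace (RtoC (-1)) with (- RtoC 1)%C by now rewrite <- RtoC_opp.
  ring.
Qed.

Lemma CV_radius_Qspan (G : (nat -> C) -> Prop) (B : R) (e : bool) (a : nat -> R) :
  (forall g, G g -> forall n, Cmod (g n) <= B) -> Qspan G (twist e a) ->
  Rbar_le 1 (CV_radius a).
Proof.
  intros HG Ha. destruct (Qspan_bounded _ _ _ HG Ha) as [M HM].
  apply CV_radius_ge_1_bounded with M. intros n. now rewrite <- (Cmod_twist e).
Qed.

(** * Coefficients of multiple polylogarithms *)

(* The generating function of [polylog_coef d] is the multiple polylogarithm with
   data [d], whose value at [1] is the L-value of [d]. *)
Definition polylog_coef (d : list (nat * C)) (n : nat) : C :=
  match d, n with
  | nil, O => RtoC 1
  | (s, a) :: d', S m => (a ^ n * / RtoC (INR n ^ s) * Lpart m d')%C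
  | _, _ => RtoC 0
  end.

Lemma sum_n_polylog_coef (d : list (nat * C)) (n : nat) :
  sum_n (polylog_coef d) n = Lpart n d.
Proof.
  induction n as [|n IH].
  - rewrite sum_O. now destruct d as [|[s a] d].
  - rewrite sum_Sn, IH. destruct d as [|[s a] d]; [|reflexivity].
    rewrite (plus_zero_r (G := C_AbelianMonoid)). now destruct n.
Qed.

Lemma RtoC_INR_S_neq_0 (n : nat) : RtoC (INR (S n)) <> RtoC 0.
Proof. intros H0. apply RtoC_inj in H0. revert H0. now apply not_0_INR. Qed.

Lemma RtoC_INR_S_pow_neq_0 (n s : nat) : RtoC (INR (S n) ^ s) <> RtoC 0.
Proof. rewrite RtoC_pow. apply Cpow_nz, RtoC_INR_S_neq_0. Qed.

Lemma Cmod_root_of_unity (a : C) (N : nat) :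
  (0 < N)%nat -> (a ^ N)%C = RtoC 1 -> Cmod a = 1.
Proof.
  intros HN Ha. apply (f_equal Cmod) in Ha.
  rewrite Cmod_pow, Cmod_1 in Ha. apply pow_R1 in Ha as [Ha|Ha]; [|lia].
  now rewrite Rabs_pos_eq in Ha by apply Cmod_ge_0.
Qed.

Lemma root_of_unity_neq_0 (a : C) (N : nat) :
  (0 < N)%nat -> (a ^ N)%C = RtoC 1 -> a <> RtoC 0.
Proof.
  intros HN Ha H0. apply Cmod_root_of_unity in Ha; [|exact HN].
  rewrite H0, Cmod_0 in Ha. lra.
Qed.

Definition level_data (N : nat) (d : list (nat * C)) : Prop :=
  List.Forall (fun p => (0 < fst p)%nat /\ (snd p ^ N)%C = RtoC 1) d.

Definition level_weight (N W : nat) (d : list (nat * C)) : Prop :=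
  level_data N d /\ weight (map fst d) = W.

Fixpoint prod_1_plus_inv (c : R) (n : nat) : R :=
  match n with
  | O => 1
  | S m => prod_1_plus_inv c m * (1 + / (c * INR (S m)))
  end.

Lemma prod_1_plus_inv_ge_1 (c : R) (n : nat) : 0 < c -> 1 <= prod_1_plus_inv c n.
Proof.
  intros Hc. induction n as [|n IH]; cbn [prod_1_plus_inv]; [lra|].
  assert (0 < / (c * INR (S n)))
    by (apply Rinv_0_lt_compat, Rmult_lt_0_compat, lt_0_INR; [exact Hc|lia]).
  nra.
Qed.

Lemma prod_1_plus_inv_1 (n : nat) : prod_1_plus_inv 1 n = INR (S n).
Proof.
  induction n as [|n IH]; [reflexivity|]. cbn [prod_1_plus_inv].
  rewrite IH, (S_INR (S n)). field. now apply not_0_INR.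
Qed.

Lemma ex_series_prod_1_plus_inv_2_div_sqr :
  ex_series (fun n => prod_1_plus_inv 2 n / INR (S n) ^ 2).
Proof.
  apply ex_series_telescope with (fun n => 4 * (prod_1_plus_inv 2 n / INR (S n))).
  - intros n. cbn [prod_1_plus_inv]. rewrite (S_INR (S n)).
    pose proof (prod_1_plus_inv_ge_1 2 n ltac:(lra)) as HP.
    set (P := prod_1_plus_inv 2 n) in *.
    assert (Hx : 1 <= INR (S n)) by apply INR_S_ge_1.
    set (x := INR (S n)) in *.
    replace (4 * (P / x) - 4 * (P * (1 + / (2 * x)) / (x + 1)))
      with (P / x ^ 2 + P * (x - 1) / (x ^ 2 * (x + 1))) by (field; lra).
    assert (0 <= P / x ^ 2) by (apply Rdiv_le_0_compat; nra).
    assert (0 <= P * (x - 1) / (x ^ 2 * (x + 1)))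
      by (apply Rdiv_le_0_compat; nra).
    lra.
  - intros n. pose proof (prod_1_plus_inv_ge_1 2 n ltac:(lra)).
    apply Rmult_le_pos, Rdiv_le_0_compat, lt_0_INR; [lra|lra|lia].
Qed.

Section Level.

Variable N : nat.
Hypothesis N_pos : (0 < N)%nat.

Lemma Cmod_polylog_coef_S (s : nat) (a : C) (d : list (nat * C)) (m : nat) :
  (a ^ N)%C = RtoC 1 ->
  Cmod (polylog_coef ((s, a) :: d) (S m)) = Cmod (Lpart m d) / INR (S m) ^ s.
Proof.
  intros Ha. assert (Hm : 0 < INR (S m) ^ s) by (apply pow_lt, lt_0_INR; lia).
  cbn [polylog_coef].
  rewrite !Cmod_mult, Cmod_pow, (Cmod_root_of_unity _ _ N_pos Ha), pow1.
  rewrite <- RtoC_inv by lra.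
  rewrite Cmod_R, Rabs_pos_eq by (now apply Rlt_le, Rinv_0_lt_compat).
  unfold Rdiv; ring.
Qed.

(* [sum_k c^-k H_n(1, ..., 1) = prod_(j <= n) (1 + 1 / (c j))], with [k] ones. *)
Lemma Cmod_Lpart_le (c : R) (d : list (nat * C)) (n : nat) :
  0 < c -> level_data N d ->
  Cmod (Lpart n d) <= c ^ length d * prod_1_plus_inv c n.
Proof.
  intros Hc. revert d. induction n as [|n IH]; intros d Hd.
  all: assert (Hpow : 0 < c ^ length d) by now apply pow_lt.
  - destruct d as [|[s a] d]; cbn [Lpart prod_1_plus_inv];
      rewrite ?Cmod_1, ?Cmod_0; simpl in *; lra.
  - destruct d as [|[s a] d].
    { pose proof (prod_1_plus_inv_ge_1 c (S n) Hc).
      cbn [Lpart length pow]. rewrite Cmod_1. lra. }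
    inversion_clear Hd as [|? ? [Hs Ha] Hd'].
    change (Lpart (S n) ((s, a) :: d))
      with (Lpart n ((s, a) :: d) + polylog_coef ((s, a) :: d) (S n))%C.
    eapply Rle_trans; [apply Cmod_triangle|].
    rewrite Cmod_polylog_coef_S by exact Ha.
    specialize (IH ((s, a) :: d)) as IHsd. specialize (IH d Hd').
    assert (Hx : 1 <= INR (S n)) by apply INR_S_ge_1.
    cbn [length prod_1_plus_inv] in *. rewrite <- !tech_pow_Rmult in *.
    apply Rle_trans with (c * c ^ length d * prod_1_plus_inv c n
      + c ^ length d * prod_1_plus_inv c n / INR (S n)).
    + apply Rplus_le_compat; [apply IHsd; now constructor|].
      apply Rmult_le_compat; [apply Cmod_ge_0| |exact IH|].
      * apply Rlt_le, Rinv_0_lt_compat, pow_lt; lra.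
      * apply Rinv_le_contravar; [lra|]. rewrite <- (pow_1 (INR (S n))) at 1.
        now apply Rle_pow.
    + right. field. lra.
Qed.

Lemma Cmod_Lpart_le_S (d : list (nat * C)) (n : nat) :
  level_data N d -> Cmod (Lpart n d) <= INR (S n).
Proof.
  intros Hd. pose proof (Cmod_Lpart_le 1 d n Rlt_0_1 Hd) as Hle.
  now rewrite pow1, Rmult_1_l, prod_1_plus_inv_1 in Hle.
Qed.

Lemma Cmod_polylog_coef_le_1 (d : list (nat * C)) (n : nat) :
  level_data N d -> Cmod (polylog_coef d n) <= 1.
Proof.
  intros Hd. destruct d as [|[s a] d], n as [|n].
  1-3: cbn [polylog_coef]; rewrite ?Cmod_1, ?Cmod_0; lra.
  inversion_clear Hd as [|? ? [Hs Ha] Hd']. cbn [fst snd] in *.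
  rewrite Cmod_polylog_coef_S by exact Ha.
  assert (Hx : 1 <= INR (S n)) by apply INR_S_ge_1.
  apply Rle_div_l; [apply pow_lt; lra|]. rewrite Rmult_1_l.
  eapply Rle_trans; [now apply Cmod_Lpart_le_S|].
  rewrite <- (pow_1 (INR (S n))) at 1. now apply Rle_pow.
Qed.

Lemma ex_series_polylog_coef (s : nat) (a : C) (d : list (nat * C)) :
  (2 <= s)%nat -> level_data N ((s, a) :: d) ->
  ex_series (V := C_NormedModule) (polylog_coef ((s, a) :: d)).
Proof.
  intros Hs Hd. inversion_clear Hd as [|? ? [_ Ha] Hd'].
  apply (ex_series_incr_1 (V := C_NormedModule)).
  apply (ex_series_le (V := C_CompleteNormedModule)) with
    (b := fun n => 2 ^ length d * (prod_1_plus_inv 2 n / INR (S n) ^ 2)).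
  - intros n. change (Cmod (polylog_coef ((s, a) :: d) (S n)) <=
      2 ^ length d * (prod_1_plus_inv 2 n / INR (S n) ^ 2)).
    rewrite Cmod_polylog_coef_S by exact Ha.
    assert (Hx : 1 <= INR (S n)) by apply INR_S_ge_1.
    unfold Rdiv. rewrite <- Rmult_assoc.
    apply Rmult_le_compat; [apply Cmod_ge_0| |apply Cmod_Lpart_le; [lra|exact Hd']|].
    + apply Rlt_le, Rinv_0_lt_compat, pow_lt; lra.
    + apply Rinv_le_contravar; [apply pow_lt; lra|now apply Rle_pow].
  - apply (ex_series_scal (V := R_NormedModule)), ex_series_prod_1_plus_inv_2_div_sqr.
Qed.

Definition polylog_seq (W : nat) : (nat -> C) -> Prop :=
  Qspan (fun z => exists d, level_weight N W d /\ z = polylog_coef d).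

(* [eta^(n+1)] are the coefficients of [eta / (1 - eta t)]. *)
Definition kernel_seq : (nat -> C) -> Prop :=
  Qspan (fun z => exists eta, (eta ^ N)%C = RtoC 1 /\ z = fun n => (eta ^ S n)%C).

Lemma polylog_seq_coef_nil : polylog_seq 0 (polylog_coef nil).
Proof.
  apply Qspan_gen. exists nil. split; [|reflexivity].
  split; [constructor|reflexivity].
Qed.

Lemma polylog_seq_S_at_0 (W : nat) (z : nat -> C) :
  polylog_seq (S W) z -> z O = RtoC 0.
Proof.
  intros Hz. induction Hz as [z Hz|q g z z' (d & [_ Hw] & ->) _ IH Hz']; [apply Hz|].
  rewrite Hz', IH. destruct d as [|[s a] d]; [discriminate Hw|].
  cbn [polylog_coef]. ring.
Qed.

Lemma CPS_Int_decr_1_polylog_coef_cons (s : nat) (a : C) (d : list (nat * C))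
    (n : nat) :
  CPS_Int (CPS_decr_1 (polylog_coef ((s, a) :: d))) n
  = polylog_coef ((S s, a) :: d) n.
Proof.
  destruct n as [|n]; [reflexivity|]. cbn [CPS_Int CPS_decr_1 polylog_coef].
  unfold CPS_decr_1. cbn [polylog_coef].
  rewrite <- tech_pow_Rmult, RtoC_mult. field.
  split; [apply RtoC_INR_S_pow_neq_0|apply RtoC_INR_S_neq_0].
Qed.

Lemma CPS_Int_decr_1_polylog_coef_nil (n : nat) :
  CPS_Int (CPS_decr_1 (polylog_coef nil)) n = RtoC 0.
Proof. destruct n; cbn; [|unfold Cdiv]; ring. Qed.

Lemma level_weight_incr_head (W s : nat) (a : C) (d : list (nat * C)) :
  level_weight N W ((s, a) :: d) -> level_weight N (S W) ((S s, a) :: d).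
Proof.
  intros [Hd Hw]. inversion_clear Hd as [|? ? [_ Ha] Hd'].
  split; [constructor; [split; [simpl; lia|exact Ha]|exact Hd']|].
  simpl in *; lia.
Qed.

(* Integration against [dt / t]. *)
Lemma polylog_seq_Int_decr_1 (W : nat) (z : nat -> C) :
  polylog_seq W z -> polylog_seq (S W) (CPS_Int (CPS_decr_1 z)).
Proof.
  apply (Qspan_map _ _ _ _ (Qlinear_comp _ _ Qlinear_Int Qlinear_decr_1)).
  intros g ([|[s a] d] & Hd & ->).
  - apply Qspan_zero, CPS_Int_decr_1_polylog_coef_nil.
  - apply Qspan_ext with (polylog_coef ((S s, a) :: d)).
    + intros n. symmetry. apply CPS_Int_decr_1_polylog_coef_cons.
    + apply Qspan_gen. exists ((S s, a) :: d). split; [|reflexivity].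
      now apply level_weight_incr_head.
Qed.

(* Integrating [t^n_1] against [eta dt / (1 - eta t)] produces the terms
   [eta^(n_0 - n_1) t^n_0 / n_0] with [n_0 > n_1]: a new leading root [eta], at the
   price of dividing the old one by [eta]. *)
Definition head_div (eta : C) (d : list (nat * C)) : list (nat * C) :=
  match d with
  | nil => nil
  | (s, a) :: d' => (s, (a / eta)%C) :: d'
  end.

Lemma CPS_mult_polylog_coef_kernel (eta : C) (d : list (nat * C)) (n : nat) :
  eta <> RtoC 0 ->
  CPS_mult (polylog_coef d) (fun k => (eta ^ S k)%C) n
  = (eta ^ S n * Lpart n (head_div eta d))%C.
Proof.
  intros Heta. unfold CPS_mult. rewrite <- sum_n_polylog_coef.
  rewrite <- (sum_n_mult_l (K := C_Ring) (eta ^ S n)%C).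
  apply (sum_n_ext_loc (G := C_AbelianMonoid)). intros k Hk.
  change (polylog_coef d k * eta ^ S (n - k)
    = eta ^ S n * polylog_coef (head_div eta d) k)%C.
  destruct d as [|[s a] d], k as [|k]; cbn [head_div polylog_coef];
    rewrite ?Nat.sub_0_r; try (cbn; ring).
  replace (S n) with (S (n - S k) + S k)%nat at 1 by lia.
  unfold Cdiv. rewrite Cpow_mult_l, Cpow_inv, Cpow_add_r by exact Heta.
  field. split; [apply RtoC_INR_S_pow_neq_0|now apply Cpow_nz].
Qed.

Lemma level_weight_cons_head_div (W : nat) (eta : C) (d : list (nat * C)) :
  (eta ^ N)%C = RtoC 1 -> level_weight N W d ->
  level_weight N (S W) ((1%nat, eta) :: head_div eta d).
Proof.
  intros Heta [Hd Hw]. destruct d as [|[s a] d].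
  - split; [constructor; [split; [simpl; lia|exact Heta]|constructor]|].
    simpl in *; lia.
  - inversion_clear Hd as [|? ? [Hs Ha] Hd']. cbn [fst snd] in *.
    split; [|simpl in *; lia].
    constructor; [split; [simpl; lia|exact Heta]|].
    constructor; [split; [exact Hs|]|exact Hd']. cbn [snd]. unfold Cdiv.
    rewrite Cpow_mult_l, Cpow_inv, Ha, Heta
      by now apply root_of_unity_neq_0 with N.
    field.
Qed.

Lemma polylog_seq_Int_mult (W : nat) (z k : nat -> C) :
  polylog_seq W z -> kernel_seq k -> polylog_seq (S W) (CPS_Int (CPS_mult z k)).
Proof.
  intros Hz.
  apply (Qspan_map _ _ _ _ (Qlinear_comp _ _ Qlinear_Int (Qlinear_mult_r z))).
  intros g (eta & Heta & ->). revert Hz.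
  apply (Qspan_map _ _ _ _ (Qlinear_comp _ _ Qlinear_Int (Qlinear_mult_l _))).
  intros g (d & Hd & ->).
  apply Qspan_ext with (polylog_coef ((1%nat, eta) :: head_div eta d)).
  - intros [|n]; [reflexivity|]. cbn [CPS_Int].
    rewrite CPS_mult_polylog_coef_kernel by now apply root_of_unity_neq_0 with N.
    cbn [polylog_coef]. rewrite pow_1. unfold Cdiv. ring.
  - apply Qspan_gen. exists ((1%nat, eta) :: head_div eta d).
    split; [now apply level_weight_cons_head_div|reflexivity].
Qed.

Lemma in_CMZV_0 (W : nat) : in_CMZV N W (RtoC 0).
Proof. exists nil. split; [constructor|reflexivity]. Qed.

Lemma in_CMZV_L (W : nat) (d : list (nat * C)) (v : C) :
  admissible N W d -> is_L d v -> in_CMZV N W v.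
Proof.
  intros Hd Hv. exists ((1%Q, d, v) :: nil). split; [now repeat constructor|].
  cbn [fold_right fst snd]. rewrite Q2R_integer. ring.
Qed.

Lemma in_CMZV_lincomb (W : nat) (q : Q) (u v : C) :
  in_CMZV N W u -> in_CMZV N W v -> in_CMZV N W (RtoC (Q2R q) * u + v)%C.
Proof.
  intros (lu & Hlu & ->) (lv & Hlv & ->). revert Hlu.
  induction lu as [|[[r d] x] lu IH]; intros Hlu.
  - exists lv. split; [exact Hlv|]. cbn [fold_right]. ring.
  - inversion_clear Hlu as [|? ? Hx Hlu']. destruct (IH Hlu') as (l & Hl & Heq).
    exists ((q * r, d, x)%Q :: l). split; [now constructor|].
    cbn [fold_right fst snd] in *. rewrite <- Heq, Q2R_mult, RtoC_mult. ring.
Qed.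

Lemma is_series_Int_decr_1_polylog_coef (W : nat) (d : list (nat * C)) :
  level_weight N W d ->
  exists v, is_series (V := C_NormedModule) (CPS_Int (CPS_decr_1 (polylog_coef d))) v
    /\ in_CMZV N (S W) v.
Proof.
  intros Hd. destruct d as [|[s a] d].
  { exists (RtoC 0). split; [|apply in_CMZV_0].
    apply (is_series_zero (V := C_NormedModule)), CPS_Int_decr_1_polylog_coef_nil. }
  assert (Hs : (0 < s)%nat) by (destruct Hd as [Hd _]; now inversion_clear Hd).
  apply level_weight_incr_head in Hd as [Hd Hw].
  destruct (ex_series_polylog_coef (S s) a d) as [v Hv]; [lia|exact Hd|].
  exists v. split.
  - eapply (is_series_ext (V := C_NormedModule)); [|exact Hv].
    intros n. symmetry. apply CPS_Int_decr_1_polylog_coef_cons.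
  - apply in_CMZV_L with ((S s, a) :: d).
    + split; [left; lia|]. now split.
    + unfold is_L. eapply filterlim_ext; [|exact Hv].
      intros n. apply sum_n_polylog_coef.
Qed.

Lemma is_series_Int_decr_1_in_CMZV (W : nat) (z : nat -> C) :
  polylog_seq W z ->
  exists v, is_series (V := C_NormedModule) (CPS_Int (CPS_decr_1 z)) v
    /\ in_CMZV N (S W) v.
Proof.
  assert (Hlin := Qlinear_comp _ _ Qlinear_Int Qlinear_decr_1).
  intros Hz. induction Hz as [z Hz|q g z z' (d & Hd & ->) _ (v & Hv & HCv) Hz'].
  - exists (RtoC 0). split; [|apply in_CMZV_0].
    apply (is_series_zero (V := C_NormedModule)).
    intros n. now apply (Qlinear_zero _ _ _ Hlin).
  - destruct (is_series_Int_decr_1_polylog_coef W d Hd) as (u & Hu & HCu).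
    exists (RtoC (Q2R q) * u + v)%C. split; [|now apply in_CMZV_lincomb].
    eapply (is_series_ext (V := C_NormedModule));
      [intros n; symmetry; apply (Hlin q _ _ _ Hz')|].
    apply (is_series_plus (V := C_NormedModule)); [|exact Hv].
    now apply (is_series_scal (V := C_NormedModule) (RtoC (Q2R q))).
Qed.

Lemma polylog_seq_radius (W : nat) (e : bool) (a : nat -> R) :
  polylog_seq W (twist e a) -> Rbar_le 1 (CV_radius a).
Proof.
  apply CV_radius_Qspan with 1. intros g (d & [Hd _] & ->) n.
  now apply Cmod_polylog_coef_le_1.
Qed.

Lemma kernel_seq_radius (e : bool) (k : nat -> R) :
  kernel_seq (twist e k) -> Rbar_le 1 (CV_radius k).
Proof.
  apply CV_radius_Qspan with 1. intros g (eta & Heta & ->) n.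
  rewrite Cmod_pow, (Cmod_root_of_unity eta N), pow1 by assumption. lra.
Qed.

Lemma polylog_seq_twist_S_at_0 (W : nat) (e : bool) (a : nat -> R) :
  polylog_seq (S W) (twist e a) -> a O = 0.
Proof.
  intros Ha. apply polylog_seq_S_at_0, (f_equal Cmod) in Ha.
  rewrite Cmod_twist, Cmod_0 in Ha.
  destruct (Req_dec (a O) 0) as [H0|H0]; [exact H0|].
  now apply Rabs_no_R0 in H0.
Qed.

Lemma polylog_seq_twist_Int_decr_1 (W : nat) (e : bool) (a : nat -> R) :
  polylog_seq W (twist e a) -> polylog_seq (S W) (twist e (PS_Int (PS_decr_1 a))).
Proof.
  intros Ha. eapply Qspan_ext; [|exact (polylog_seq_Int_decr_1 _ _ Ha)].
  apply (CPS_Int_twist e (PS_decr_1 a)).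
Qed.

Lemma polylog_seq_twist_Int_mult (W : nat) (e e' : bool) (a k : nat -> R) :
  polylog_seq W (twist e a) -> kernel_seq (twist e' k) ->
  polylog_seq (S W) (twist (xorb e e') (PS_Int (PS_mult a k))).
Proof.
  intros Ha Hk. set (q := (if e && e' then -1 else 1)%Q).
  set (z := CPS_mult (twist e a) (twist e' k)).
  apply Qspan_ext with (fun n => RtoC (Q2R q) * CPS_Int z n)%C.
  - intros n. rewrite <- CPS_Int_twist.
    rewrite (Qlinear_Int q z (fun _ => RtoC 0) (twist _ (PS_mult a k))).
    + rewrite (Qlinear_zero _ (fun _ => RtoC 0) n Qlinear_Int) by reflexivity. ring.
    + intros m. rewrite CPS_mult_twist. fold q z. ring.
  - now apply Qspan_scal, polylog_seq_Int_mult.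
Qed.

(** * Functions with polylogarithmic Taylor series *)

Definition polylog_fun (W : nat) (e : bool) (f : R -> R) : Prop :=
  exists a, polylog_seq W (twist e a) /\ forall t, 0 <= t < 1 -> f t = PSeries a t.

Lemma polylog_fun_1 : polylog_fun 0 false (fun _ => 1).
Proof.
  exists PS_one. split.
  - eapply Qspan_ext; [|exact polylog_seq_coef_nil].
    intros [|n]; unfold twist; cbn; ring.
  - intros t Ht. symmetry. apply PSeries_PS_one. rewrite Rabs_pos_eq; lra.
Qed.

Lemma polylog_fun_scal (W : nat) (e : bool) (q : Q) (f : R -> R) :
  polylog_fun W e f -> polylog_fun W e (fun t => Q2R q * f t).
Proof.
  intros (a & Ha & Hf). exists (PS_scal (Q2R q) a). split.
  - eapply Qspan_ext; [|exact (Qspan_scal _ q _ Ha)]. intros n.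
    now rewrite twist_scal.
  - intros t Ht. now rewrite PSeries_scal, Hf.
Qed.

Lemma polylog_fun_double (W : nat) (e : bool) (f : R -> R) :
  polylog_fun W e f -> polylog_fun W e (fun t => 2 * f t).
Proof. intros Hf. rewrite <- (Q2R_integer 2). now apply polylog_fun_scal. Qed.

Lemma polylog_fun_primitive (W : nat) (e : bool) (c : nat -> R) (F : R -> R) :
  polylog_seq W (twist e (PS_Int c)) -> is_primitive F (PSeries c) ->
  polylog_fun W e F.
Proof.
  intros Hc HF. exists (PS_Int c). split; [exact Hc|]. intros t Ht.
  apply is_primitive_unique with (PSeries c); [exact HF| |exact Ht].
  apply is_primitive_PS_Int. rewrite <- CV_radius_Int.
  now apply polylog_seq_radius in Hc.
Qed.

Lemma polylog_fun_int_kernel (W : nat) (e e' : bool) (k : nat -> R) (f F : R -> R) :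
  polylog_fun W e f -> kernel_seq (twist e' k) ->
  is_primitive F (fun t => PSeries k t * f t) -> polylog_fun (S W) (xorb e e') F.
Proof.
  intros (a & Ha & Hf) Hk HF.
  apply polylog_fun_primitive with (PS_mult a k);
    [now apply polylog_seq_twist_Int_mult|].
  eapply is_primitive_ext; [|exact HF]. intros t Ht. cbv beta.
  rewrite Hf, PSeries_mult_unit_disk by
    (eauto using polylog_seq_radius, kernel_seq_radius; rewrite ?Rabs_pos_eq; lra).
  ring.
Qed.

Lemma polylog_fun_int_dlog_kernel (W : nat) (e : bool) (k : nat -> R) (f F : R -> R) :
  polylog_fun (S W) e f -> kernel_seq (twist false k) ->
  is_primitive F (fun t => (/ t + PSeries k t) * f t) -> polylog_fun (S (S W)) e F.
Proof.
  intros (a & Ha & Hf) Hk HF.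
  assert (Hdecr := polylog_seq_twist_Int_decr_1 _ _ _ Ha).
  assert (Hmult := polylog_seq_twist_Int_mult _ _ _ _ _ Ha Hk).
  rewrite xorb_false_r in Hmult.
  apply polylog_fun_primitive with (PS_plus (PS_decr_1 a) (PS_mult a k)).
  - eapply Qspan_ext; [|exact (Qspan_plus _ _ _ Hdecr Hmult)]. intros n. cbv beta.
    rewrite <- twist_plus. unfold twist. now rewrite PS_Int_plus.
  - eapply is_primitive_ext; [|exact HF]. intros t Ht. cbv beta.
    assert (Ht1 : Rabs t < 1) by (rewrite Rabs_pos_eq; lra).
    apply polylog_seq_radius in Hdecr, Hmult. rewrite CV_radius_Int in Hdecr, Hmult.
    rewrite PSeries_plus by now apply ex_pseries_unit_disk.
    rewrite PSeries_decr_1_div, PSeries_mult_unit_disk, Hf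
      by (eauto using polylog_seq_radius, kernel_seq_radius,
            polylog_seq_twist_S_at_0; lra).
    unfold Rdiv; ring.
Qed.

Lemma polylog_fun_int_dlog_in_CMZV (W : nat) (f : R -> R) :
  polylog_fun (S W) false f ->
  exists (F : R -> R) (l : R),
    is_primitive F (fun t => f t / t) /\ filterlim F (at_left 1) (locally l) /\
    in_CMZV N (S (S W)) (RtoC l).
Proof.
  intros (a & Ha & Hf).
  destruct (is_series_Int_decr_1_in_CMZV _ _ Ha) as (v & Hv & HCv).
  apply (is_series_ext (V := C_NormedModule)) with
    (b := fun n => RtoC (PS_Int (PS_decr_1 a) n)) in Hv.
  2:{ intros n. rewrite <- (Cmult_1_r (RtoC _)).
      exact (CPS_Int_twist false (PS_decr_1 a) n). }
  apply is_series_RtoC in Hv as (l & -> & Hl).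
  assert (Hrad := polylog_seq_radius _ _ _ (polylog_seq_twist_Int_decr_1 _ _ _ Ha)).
  exists (PSeries (PS_Int (PS_decr_1 a))), l. split; [|split; [|exact HCv]].
  - eapply is_primitive_ext;
      [|apply is_primitive_PS_Int; now rewrite <- CV_radius_Int].
    intros t Ht. cbv beta. rewrite Hf by lra.
    apply PSeries_decr_1_div; [now apply polylog_seq_twist_S_at_0 in Ha|lra].
  - now apply PSeries_at_left_1.
Qed.

End Level.

(** * The substitution [t = tan (theta / 2)] *)

Fixpoint geom_sqr (eps : R) (n : nat) : R :=
  match n with
  | O => 1
  | S O => 0
  | S (S m) => eps * geom_sqr eps m
  end.

Lemma Rabs_geom_sqr_le_1 (eps : R) (n : nat) :
  -1 <= eps <= 1 -> Rabs (geom_sqr eps n) <= 1.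
Proof.
  intros Heps. revert n. fix IH 1. intros [|[|n]]; cbn [geom_sqr].
  - rewrite Rabs_R1. lra.
  - rewrite Rabs_R0. lra.
  - rewrite Rabs_mult. specialize (IH n). apply Rabs_le in Heps.
    pose proof (Rabs_pos eps). pose proof (Rabs_pos (geom_sqr eps n)). nra.
Qed.

Lemma PSeries_geom_sqr (eps t : R) :
  -1 <= eps <= 1 -> Rabs t < 1 -> PSeries (geom_sqr eps) t = / (1 - eps * t ^ 2).
Proof.
  intros Heps Ht.
  assert (Hex : forall m, ex_pseries (fun n => geom_sqr eps (m + n)) t).
  { intros m. apply ex_pseries_unit_disk; [|exact Ht].
    apply CV_radius_ge_1_bounded with 1. intros n. now apply Rabs_geom_sqr_le_1. }
  assert (Hsum : PSeries (geom_sqr eps) t = 1 + eps * t ^ 2 * PSeries (geom_sqr eps) t).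
  { rewrite (PSeries_decr_1 (geom_sqr eps)) at 1 by exact (Hex O).
    rewrite (PSeries_decr_1 (PS_decr_1 _)) at 1 by exact (Hex 1%nat).
    rewrite (PSeries_ext (PS_decr_1 (PS_decr_1 _)) (PS_scal eps (geom_sqr eps)))
      by reflexivity.
    rewrite PSeries_scal. unfold PS_decr_1. cbn [geom_sqr]. ring. }
  assert (Hpos : 1 - eps * t ^ 2 <> 0).
  { apply Rabs_def2 in Ht. nra. }
  apply Rmult_eq_reg_l with (1 - eps * t ^ 2); [|exact Hpos].
  rewrite Rinv_r by exact Hpos. lra.
Qed.

(* The even and odd parts of [eta / (1 - eta t) = (eta + eps t) / (1 - eps t^2)]. *)
Lemma Cpow_S_geom_sqr (eta : C) (eps : R) (n : nat) :
  (eta * eta)%C = RtoC eps ->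
  (eta ^ S n)%C
  = (eta * RtoC (geom_sqr eps n) + RtoC eps * RtoC (PS_incr_1 (geom_sqr eps) n))%C.
Proof.
  intros Heta. revert n. fix IH 1. intros [|[|n]].
  - cbn. ring.
  - cbn. rewrite <- Heta. ring.
  - replace (eta ^ S (S (S n)))%C with (eta * eta * eta ^ S n)%C by (cbn; ring).
    rewrite IH, Heta. cbn [geom_sqr]. rewrite RtoC_mult.
    destruct n as [|n]; cbn -[geom_sqr]; [cbn; ring|].
    cbn [geom_sqr]. rewrite RtoC_mult. ring.
Qed.

Lemma Cpow_4_of_sqr (eta : C) (eps : R) :
  (eta * eta)%C = RtoC eps -> eps * eps = 1 -> (eta ^ 4)%C = RtoC 1.
Proof.
  intros Heta Heps. rewrite <- Heps, RtoC_mult, <- Heta. cbn. ring.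
Qed.

Lemma kernel_seq_root (N : nat) (eta : C) :
  (eta ^ N)%C = RtoC 1 -> kernel_seq N (fun n => (eta ^ S n)%C).
Proof. intros Heta. apply Qspan_gen. now exists eta. Qed.

Lemma Ci_opp_sqr : ((- Ci) * (- Ci))%C = RtoC (-1).
Proof. rewrite <- Ci_sqr. ring. Qed.

(* The coefficients of [2 / (1 + t^2)]. *)
Definition dtheta_kernel : nat -> R := PS_scal 2 (geom_sqr (-1)).

Lemma kernel_seq_dtheta : kernel_seq 4 (twist true dtheta_kernel).
Proof.
  assert (Hroot : forall eta, (eta * eta)%C = RtoC (-1) ->
    kernel_seq 4 (fun n => (eta ^ S n)%C)).
  { intros eta Heta. apply kernel_seq_root, (Cpow_4_of_sqr _ _ Heta). ring. }
  eapply Qspan_ext; [|exact (Qspan_plus _ _ _ (Hroot _ Ci_sqr)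
    (Qspan_scal _ (-1)%Q _ (Hroot _ Ci_opp_sqr)))].
  intros n. cbv beta. unfold dtheta_kernel. rewrite twist_scal.
  rewrite (Cpow_S_geom_sqr _ _ n Ci_sqr), (Cpow_S_geom_sqr _ _ n Ci_opp_sqr).
  unfold twist. rewrite Q2R_integer. change (-1) with (Ropp 1).
  rewrite RtoC_opp. cbn [Ci_power]. ring.
Qed.

(* The coefficients of [2 eps t / (1 - eps t^2)]. *)
Definition odd_kernel (eps : R) : nat -> R :=
  PS_scal (2 * eps) (PS_incr_1 (geom_sqr eps)).

Lemma kernel_seq_odd (eta : C) (eps : R) :
  (eta * eta)%C = RtoC eps -> eps * eps = 1 ->
  kernel_seq 4 (twist false (odd_kernel eps)).
Proof.
  intros Heta Heps.
  assert (Hopp : ((- eta) * (- eta))%C = RtoC eps) by (rewrite <- Heta; ring).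
  eapply Qspan_ext; [|exact (Qspan_plus _ _ _
    (kernel_seq_root 4 _ (Cpow_4_of_sqr _ _ Heta Heps))
    (kernel_seq_root 4 _ (Cpow_4_of_sqr _ _ Hopp Heps)))].
  intros n. cbv beta. unfold odd_kernel. rewrite twist_scal.
  rewrite (Cpow_S_geom_sqr _ _ n Heta), (Cpow_S_geom_sqr _ _ n Hopp).
  unfold twist. rewrite RtoC_mult. cbn [Ci_power]. ring.
Qed.

Lemma PSeries_odd_kernel (eps t : R) :
  -1 <= eps <= 1 -> Rabs t < 1 ->
  PSeries (odd_kernel eps) t = 2 * eps * t / (1 - eps * t ^ 2).
Proof.
  intros Heps Ht. unfold odd_kernel.
  rewrite PSeries_scal, PSeries_incr_1, PSeries_geom_sqr by assumption.
  unfold Rdiv. ring.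
Qed.

(* Sine, cosine and derivative of [theta = 2 atan t]. *)
Definition sin2atan (t : R) : R := 2 * t / (1 + t ^ 2).
Definition cos2atan (t : R) : R := (1 - t ^ 2) / (1 + t ^ 2).
Definition dtheta (t : R) : R := 2 / (1 + t ^ 2).

Lemma sin2_cos2_2atan (t : R) : sin2atan t ^ 2 + cos2atan t ^ 2 = 1.
Proof. unfold sin2atan, cos2atan. field. nra. Qed.

Lemma is_derive_sin2atan (t : R) : is_derive sin2atan t (cos2atan t * dtheta t).
Proof. unfold sin2atan, cos2atan, dtheta. auto_derive; [nra|]. field. nra. Qed.

Lemma is_derive_cos2atan (t : R) : is_derive cos2atan t (- sin2atan t * dtheta t).
Proof. unfold sin2atan, cos2atan, dtheta. auto_derive; [nra|]. field. nra. Qed.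

Lemma dtheta_bounds (t : R) : 0 <= dtheta t <= 2.
Proof.
  unfold dtheta. split; [apply Rdiv_le_0_compat; nra|].
  apply Rle_div_l; nra.
Qed.

Lemma sin2atan_pos (t : R) : 0 < t -> 0 < sin2atan t.
Proof. intros Ht. unfold sin2atan. apply Rdiv_lt_0_compat; nra. Qed.

Lemma cos2atan_pos (t : R) : 0 <= t < 1 -> 0 < cos2atan t.
Proof. intros Ht. unfold cos2atan. apply Rdiv_lt_0_compat; nra. Qed.

Lemma sin2atan_0 : sin2atan 0 = 0.
Proof. unfold sin2atan. field. Qed.

Lemma sin2atan_incr (t r : R) : 0 <= t <= r -> r <= 1 -> 0 <= sin2atan t <= sin2atan r.
Proof.
  intros Ht Hr. split.
  - unfold sin2atan. apply Rdiv_le_0_compat; nra.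
  - apply le_of_derive_nonneg with (fun t => cos2atan t * dtheta t);
      [lra|intros x _; apply is_derive_sin2atan|].
    intros x Hx. apply Rmult_le_pos; [|apply dtheta_bounds].
    unfold cos2atan. apply Rdiv_le_0_compat; nra.
Qed.

Lemma sin2atan_sqr_lt_1 (t : R) : 0 <= t < 1 -> sin2atan t ^ 2 < 1.
Proof.
  intros Ht. pose proof (sin2_cos2_2atan t). pose proof (cos2atan_pos t Ht). nra.
Qed.

Lemma Rabs_sin2atan_sqr_lt_1 (t : R) : 0 <= t < 1 -> Rabs (sin2atan t ^ 2) < 1.
Proof.
  intros Ht. rewrite Rabs_pos_eq by apply pow2_ge_0. now apply sin2atan_sqr_lt_1.
Qed.

Lemma is_derive_PSeries_sin2atan_sqr (a : nat -> R) (t : R) :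
  Rbar_le 1 (CV_radius a) -> 0 <= t < 1 ->
  is_derive (fun t => PSeries a (sin2atan t ^ 2)) t
    (2 * sin2atan t * cos2atan t * dtheta t * PSeries (PS_derive a) (sin2atan t ^ 2)).
Proof.
  intros Ha Ht.
  evar_last.
  - apply (is_derive_comp (PSeries a) (fun t => sin2atan t ^ 2)).
    + apply is_derive_PSeries, Rabs_lt_CV_radius; [exact Ha|].
      now apply Rabs_sin2atan_sqr_lt_1.
    + apply is_derive_pow, is_derive_sin2atan.
  - unfold scal; simpl. unfold mult; simpl. ring.
Qed.

Lemma polylog_fun_int_dtheta (W : nat) (e : bool) (f F : R -> R) :
  polylog_fun 4 W e f -> is_primitive F (fun t => dtheta t * f t) ->
  polylog_fun 4 (S W) (negb e) F.
Proof.
  intros Hf HF. rewrite <- xorb_true_r.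
  apply (polylog_fun_int_kernel 4 (Nat.lt_0_succ 3) W e true dtheta_kernel f);
    [exact Hf|exact kernel_seq_dtheta|].
  eapply is_primitive_ext; [|exact HF]. intros t Ht. cbv beta.
  unfold dtheta_kernel. rewrite PSeries_scal, PSeries_geom_sqr
    by (rewrite ?Rabs_pos_eq; lra).
  unfold dtheta. f_equal. unfold Rdiv. do 2 f_equal. ring.
Qed.

Lemma polylog_fun_int_cot (W : nat) (e : bool) (f F : R -> R) :
  polylog_fun 4 (S W) e f ->
  is_primitive F (fun t => cos2atan t / sin2atan t * dtheta t * f t) ->
  polylog_fun 4 (S (S W)) e F.
Proof.
  intros Hf HF.
  apply (polylog_fun_int_dlog_kernel 4 (Nat.lt_0_succ 3) W e (odd_kernel (-1)) f);
    [exact Hf|apply (kernel_seq_odd Ci); [exact Ci_sqr|ring]|].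
  eapply is_primitive_ext; [|exact HF]. intros t Ht. cbv beta.
  rewrite PSeries_odd_kernel by (rewrite ?Rabs_pos_eq; lra).
  unfold cos2atan, sin2atan, dtheta. field. repeat split; nra.
Qed.

(* [tan theta dtheta = 2 t / (1 - t^2) + 2 t / (1 + t^2)] *)
Lemma polylog_fun_int_tan (W : nat) (e : bool) (f F : R -> R) :
  polylog_fun 4 W e f ->
  is_primitive F (fun t => sin2atan t / cos2atan t * dtheta t * f t) ->
  polylog_fun 4 (S W) e F.
Proof.
  intros Hf HF. set (k := PS_plus (odd_kernel 1) (PS_scal (-1) (odd_kernel (-1)))).
  assert (Hk1 : kernel_seq 4 (twist false (odd_kernel 1)))
    by (apply (kernel_seq_odd (RtoC 1)); ring).
  assert (Hk2 : kernel_seq 4 (twist false (odd_kernel (-1))))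
    by (apply (kernel_seq_odd Ci); [exact Ci_sqr|ring]).
  assert (Hk : kernel_seq 4 (twist false k)).
  { eapply Qspan_ext;
      [|exact (Qspan_plus _ _ _ Hk1 (Qspan_scal _ (-1)%Q _ Hk2))].
    intros n. unfold k. now rewrite twist_plus, twist_scal, Q2R_integer. }
  rewrite <- (xorb_false_r e).
  apply (polylog_fun_int_kernel 4 (Nat.lt_0_succ 3) W e false k f);
    [exact Hf|exact Hk|].
  eapply is_primitive_ext; [|exact HF]. intros t Ht. cbv beta.
  assert (Ht1 : Rabs t < 1) by (rewrite Rabs_pos_eq; lra).
  unfold k. rewrite PSeries_plus.
  - rewrite PSeries_scal, !PSeries_odd_kernel by lra.
    unfold cos2atan, sin2atan, dtheta. field. repeat split; nra.
  - apply ex_pseries_unit_disk; [|exact Ht1].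
    now apply kernel_seq_radius in Hk1; [|lia].
  - apply ex_pseries_scal; [apply Rmult_comm|].
    apply ex_pseries_unit_disk; [|exact Ht1].
    now apply kernel_seq_radius in Hk2; [|lia].
Qed.

(** * Generating functions with inverse central binomial weights *)

Definition binom_ratio (n : nat) : R := / 4 ^ n * central_binom n.

Lemma binom_ratio_0 : binom_ratio 0 = 1.
Proof. unfold binom_ratio, central_binom. simpl. field. Qed.

Lemma binom_ratio_S (n : nat) :
  binom_ratio (S n) = binom_ratio n * (2 * INR n + 1) / (2 * INR n + 2).
Proof.
  unfold binom_ratio, central_binom. replace (2 * S n)%nat with (S (S (2 * n))) by lia.
  rewrite !fact_simpl, !mult_INR, !S_INR, mult_INR. simpl (INR 2).
  rewrite <- tech_pow_Rmult. pose proof (pos_INR n).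
  field. repeat split; try apply pow_nonzero; try apply INR_fact_neq_0; lra.
Qed.

Lemma binom_ratio_pos (n : nat) : 0 < binom_ratio n.
Proof.
  induction n as [|n IH]; [rewrite binom_ratio_0; lra|]. rewrite binom_ratio_S.
  pose proof (pos_INR n). apply Rdiv_lt_0_compat; [nra|lra].
Qed.

Lemma INR_mul_binom_ratio_ge_half (n : nat) : / 2 <= INR (S n) * binom_ratio (S n).
Proof.
  induction n as [|n IH].
  - rewrite binom_ratio_S, binom_ratio_0. simpl. lra.
  - eapply Rle_trans; [exact IH|]. rewrite (binom_ratio_S (S n)), (S_INR (S n)).
    pose proof (INR_S_ge_1 n). pose proof (binom_ratio_pos (S n)).
    set (x := INR (S n)) in *. set (b := binom_ratio (S n)) in *.
    replace ((x + 1) * (b * (2 * x + 1) / (2 * x + 2)))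
      with (x * b + b / 2) by (field; lra). lra.
Qed.

Lemma H_Lpart (n : nat) (w : list nat) :
  RtoC (H n w) = Lpart n (map (fun t => (t, RtoC 1)) w).
Proof.
  revert w. induction n as [|n IH]; intros [|t w]; try reflexivity.
  cbn [H Lpart map].
  rewrite RtoC_plus, RtoC_mult, RtoC_inv
    by (apply pow_nonzero; now apply not_0_INR).
  change (Defs.Cpow (RtoC 1) (S n)) with (RtoC 1 ^ S n)%C.
  rewrite IH, (IH w), Cpow_1_l. cbn [map]. ring.
Qed.

Lemma H_nonneg (n : nat) (w : list nat) : 0 <= H n w.
Proof.
  revert w. induction n as [|n IH]; intros [|t w]; cbn [H]; try lra.
  assert (0 < / INR (S n) ^ t)
    by (apply Rinv_0_lt_compat, pow_lt, lt_0_INR; lia).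
  specialize (IH (t :: w)) as IHtw. specialize (IH w). nra.
Qed.

Lemma H_le_S (n : nat) (w : list nat) : word_ok w -> H n w <= INR (S n).
Proof.
  intros Hw. rewrite <- (Rabs_pos_eq (H n w)), <- Cmod_R, H_Lpart by apply H_nonneg.
  apply (Cmod_Lpart_le_S 1 Nat.lt_0_1), Forall_map.
  eapply Forall_impl; [|exact Hw]. intros t Ht. split; [exact Ht|].
  cbn [snd]. apply Cpow_1_l.
Qed.

Definition harm_coef (w : list nat) (s n : nat) : R :=
  match n with
  | O => 0
  | S m => H m w / INR n ^ s * / binom_ratio n
  end.

Lemma harm_coef_nonneg (w : list nat) (s n : nat) : 0 <= harm_coef w s n.
Proof.
  destruct n as [|n]; [simpl; lra|]. cbn [harm_coef].
  apply Rmult_le_pos.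
  - apply Rdiv_le_0_compat; [apply H_nonneg|apply pow_lt, lt_0_INR; lia].
  - apply Rlt_le, Rinv_0_lt_compat, binom_ratio_pos.
Qed.

Lemma harm_coef_le (w : list nat) (s n : nat) :
  word_ok w -> harm_coef w (S s) n <= 2 * INR (S n).
Proof.
  intros Hw. destruct n as [|n]; [simpl; lra|].
  pose proof (INR_S_ge_1 n) as Hn. pose proof (INR_mul_binom_ratio_ge_half n) as Hb.
  pose proof (binom_ratio_pos (S n)) as Hb0.
  assert (Hpow : 1 <= INR (S n) ^ s) by now apply pow_R1_Rle.
  replace (harm_coef w (S s) (S n))
    with (H n w * / (INR (S n) ^ s * (INR (S n) * binom_ratio (S n)))).
  2:{ cbn [harm_coef]. rewrite <- tech_pow_Rmult. field. repeat split; lra. }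
  rewrite Rmult_comm. apply Rmult_le_compat.
  - apply Rlt_le, Rinv_0_lt_compat. nra.
  - apply H_nonneg.
  - rewrite <- (Rinv_inv 2). apply Rinv_le_contravar; nra.
  - rewrite (S_INR (S n)). pose proof (H_le_S n w Hw). lra.
Qed.

Lemma harm_coef_radius (w : list nat) (s : nat) :
  word_ok w -> (0 < s)%nat -> Rbar_le 1 (CV_radius (harm_coef w s)).
Proof.
  intros Hw Hs. destruct s as [|s]; [lia|]. apply CV_radius_ge_1_linear with 2.
  intros n. rewrite Rabs_pos_eq by apply harm_coef_nonneg. now apply harm_coef_le.
Qed.

Lemma PS_derive_harm_coef (w : list nat) (s n : nat) :
  PS_derive (harm_coef w (S s)) n = PS_decr_1 (harm_coef w s) n.
Proof.
  unfold PS_derive, PS_decr_1. cbn [harm_coef]. rewrite <- tech_pow_Rmult. field.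
  pose proof (binom_ratio_pos (S n)).
  repeat split; [lra|apply pow_nonzero|]; now apply not_0_INR.
Qed.

Lemma harm_coef_decr_radius (w : list nat) :
  word_ok w -> Rbar_le 1 (CV_radius (PS_decr_1 (harm_coef w 1))).
Proof.
  intros Hw. rewrite <- (CV_radius_ext _ _ (PS_derive_harm_coef w 1)).
  rewrite CV_radius_derive. apply harm_coef_radius; [exact Hw|lia].
Qed.

Definition harm_source (w : list nat) : nat -> R :=
  match w with nil => PS_one | t :: w' => harm_coef w' t end.

Lemma harm_source_radius (w : list nat) :
  word_ok w -> Rbar_le 1 (CV_radius (harm_source w)).
Proof.
  intros Hw. destruct Hw as [|t w Ht Hw]; [exact CV_radius_PS_one|].
  now apply harm_coef_radius.
Qed.

Lemma harm_coef_recurrence (w : list nat) (n : nat) :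
  (2 * INR n + 1) * harm_coef w 1 (S n)
  = 2 * INR n * harm_coef w 1 n + 2 * harm_source w n.
Proof.
  assert (Hfirst : (2 * INR n + 1) * harm_coef w 1 (S n) = 2 * H n w / binom_ratio n).
  { cbn [harm_coef]. rewrite binom_ratio_S, S_INR, pow_1.
    pose proof (binom_ratio_pos n). pose proof (pos_INR n). field. repeat split; lra. }
  rewrite Hfirst. destruct n as [|n].
  - rewrite binom_ratio_0. destruct w as [|t w]; simpl; field.
  - pose proof (binom_ratio_pos (S n)) as Hb. pose proof (INR_S_ge_1 n) as Hn.
    destruct w as [|t w]; cbn [harm_source harm_coef PS_one H].
    + replace (H n nil) with 1 by now destruct n. field. lra.
    + field. repeat split; try lra. apply pow_nonzero; lra.
Qed.

Lemma PSeries_harm_coef_ode (w : list nat) (x : R) :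
  word_ok w -> Rabs x < 1 ->
  let g := PS_decr_1 (harm_coef w 1) in
  2 * x * (1 - x) * PSeries (PS_derive g) x + (1 - 2 * x) * PSeries g x
  = 2 * PSeries (harm_source w) x.
Proof.
  intros Hw Hx g.
  assert (Hpow : forall a, Rbar_le 1 (CV_radius a) -> is_pseries a x (PSeries a x)).
  { intros a Ha. now apply PSeries_correct, ex_pseries_unit_disk. }
  assert (Hg := Hpow _ (harm_coef_decr_radius w Hw)). fold g in Hg.
  assert (Hr := Hpow _ (harm_source_radius w Hw)).
  assert (Hd : is_pseries (PS_derive g) x (PSeries (PS_derive g) x)).
  { apply Hpow. rewrite CV_radius_derive. now apply harm_coef_decr_radius. }
  assert (Hxd := is_pseries_incr_1 _ _ _ Hd).
  assert (Hlhs := is_pseries_plus _ _ _ _ _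
    (is_pseries_scal 2 _ _ _ (Rmult_comm _ _) Hxd) Hg).
  assert (Hrhs := is_pseries_plus _ _ _ _ _
    (is_pseries_scal 2 _ _ _ (Rmult_comm _ _)
      (is_pseries_incr_1 _ _ _ (is_pseries_plus _ _ _ _ _ Hxd Hg)))
    (is_pseries_scal 2 _ _ _ (Rmult_comm _ _) Hr)).
  apply is_pseries_unique in Hlhs, Hrhs.
  rewrite (PSeries_ext _
    (PS_plus (PS_scal 2 (PS_incr_1 (PS_plus (PS_incr_1 (PS_derive g)) g)))
             (PS_scal 2 (harm_source w)))) in Hlhs.
  - rewrite Hrhs in Hlhs. unfold plus, scal in Hlhs; simpl in Hlhs.
    unfold mult in Hlhs; simpl in Hlhs. lra.
  - intros n.
    change (2 * PS_incr_1 (PS_derive g) n + g n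
      = 2 * PS_incr_1 (PS_plus (PS_incr_1 (PS_derive g)) g) n + 2 * harm_source w n).
    replace (PS_incr_1 (PS_plus (PS_incr_1 (PS_derive g)) g) n)
      with (INR n * harm_coef w 1 n).
    + rewrite PS_incr_1_derive. pose proof (harm_coef_recurrence w n) as Hrec.
      unfold g, PS_decr_1. lra.
    + destruct n as [|n]; [exact (Rmult_0_l _)|]. cbn [PS_incr_1].
      change (INR (S n) * g n = PS_incr_1 (PS_derive g) n + g n).
      rewrite PS_incr_1_derive, S_INR. ring.
Qed.

Definition harm_gen (w : list nat) (s : nat) (t : R) : R :=
  PSeries (harm_coef w s) (sin2atan t ^ 2).

(* [cot theta * harm_gen w 1], with the singularity at [t = 0] cancelled. *)
Definition harm_cot (w : list nat) (t : R) : R :=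
  sin2atan t * cos2atan t * PSeries (PS_decr_1 (harm_coef w 1)) (sin2atan t ^ 2).

Lemma PSeries_decr_1_harm_coef (w : list nat) (s : nat) (x : R) :
  x * PSeries (PS_decr_1 (harm_coef w s)) x = PSeries (harm_coef w s) x.
Proof. symmetry. now apply PSeries_decr_1_aux. Qed.

Lemma harm_gen_1 (w : list nat) (t : R) :
  0 <= t < 1 -> harm_gen w 1 t = sin2atan t / cos2atan t * harm_cot w t.
Proof.
  intros Ht. pose proof (cos2atan_pos t Ht). unfold harm_gen, harm_cot.
  rewrite <- PSeries_decr_1_harm_coef. field. lra.
Qed.

Lemma is_primitive_harm_gen_decr (w : list nat) (s : nat) :
  word_ok w ->
  is_primitive (harm_gen w (S s)) (fun t => 2 * sin2atan t * cos2atan t * dtheta t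
    * PSeries (PS_decr_1 (harm_coef w s)) (sin2atan t ^ 2)).
Proof.
  intros Hw. apply is_primitive_of_derive.
  - unfold harm_gen. rewrite sin2atan_0, pow_i by lia. apply PSeries_0.
  - intros t Ht. rewrite <- (PSeries_ext _ _ _ (PS_derive_harm_coef w s)).
    apply is_derive_PSeries_sin2atan_sqr; [|exact Ht].
    apply harm_coef_radius; [exact Hw|lia].
Qed.

Lemma is_primitive_harm_gen_2 (w : list nat) :
  word_ok w -> is_primitive (harm_gen w 2) (fun t => dtheta t * (2 * harm_cot w t)).
Proof.
  intros Hw. eapply is_primitive_ext; [|now apply is_primitive_harm_gen_decr].
  intros t _. unfold harm_cot. ring.
Qed.

Lemma is_primitive_harm_gen_S (w : list nat) (s : nat) :
  word_ok w ->
  is_primitive (harm_gen w (S s))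
    (fun t => cos2atan t / sin2atan t * dtheta t * (2 * harm_gen w s t)).
Proof.
  intros Hw. eapply is_primitive_ext; [|now apply is_primitive_harm_gen_decr].
  intros t Ht. pose proof (sin2atan_pos t ltac:(lra)). unfold harm_gen.
  rewrite <- (PSeries_decr_1_harm_coef w s). field. lra.
Qed.

Lemma is_primitive_harm_cot (w : list nat) :
  word_ok w ->
  is_primitive (harm_cot w)
    (fun t => dtheta t * (2 * PSeries (harm_source w) (sin2atan t ^ 2))).
Proof.
  intros Hw. apply is_primitive_of_derive.
  { unfold harm_cot. rewrite sin2atan_0. ring. }
  intros t Ht. set (g := PS_decr_1 (harm_coef w 1)).
  assert (Hode := PSeries_harm_coef_ode w _ Hw (Rabs_sin2atan_sqr_lt_1 t Ht)).
  fold g in Hode. cbv zeta in Hode.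
  evar_last.
  - unfold harm_cot. fold g.
    apply (is_derive_mult (fun t => sin2atan t * cos2atan t)
             (fun t => PSeries g (sin2atan t ^ 2))); [| |exact Rmult_comm].
    + apply (is_derive_mult sin2atan cos2atan); [| |exact Rmult_comm].
      * apply is_derive_sin2atan.
      * apply is_derive_cos2atan.
    + apply is_derive_PSeries_sin2atan_sqr; [now apply harm_coef_decr_radius|exact Ht].
  - unfold plus, mult; simpl. unfold mult; simpl.
    change (sin2atan t * (sin2atan t * 1)) with (sin2atan t ^ 2).
    rewrite <- Hode.
    replace (1 - sin2atan t ^ 2) with (cos2atan t ^ 2)
      by (pose proof (sin2_cos2_2atan t); lra).
    replace (1 - 2 * sin2atan t ^ 2) with (cos2atan t ^ 2 - sin2atan t ^ 2)
      by (pose proof (sin2_cos2_2atan t); lra).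
    ring.
Qed.

Lemma polylog_fun_harm_gen (w : list nat) (W k : nat) :
  word_ok w -> polylog_fun 4 W true (harm_cot w) ->
  polylog_fun 4 (S k + W) false (harm_gen w (S (S k))).
Proof.
  intros Hw Hcot. induction k as [|k IH].
  - apply (polylog_fun_int_dtheta W true (fun t => 2 * harm_cot w t));
      [now apply polylog_fun_double|now apply is_primitive_harm_gen_2].
  - apply (polylog_fun_int_cot (k + W) false (fun t => 2 * harm_gen w (S (S k)) t));
      [now apply polylog_fun_double|now apply is_primitive_harm_gen_S].
Qed.

Lemma polylog_fun_harm_cot (w : list nat) :
  word_ok w -> polylog_fun 4 (S (weight w)) true (harm_cot w).
Proof.
  intros Hw. induction Hw as [|p w Hp Hw IH].
  - apply (polylog_fun_int_dtheta 0 false (fun _ => 2 * 1)).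
    + apply polylog_fun_double, polylog_fun_1.
    + eapply is_primitive_ext; [|apply is_primitive_harm_cot; constructor].
      intros t Ht. cbn [harm_source].
      rewrite PSeries_PS_one by (apply Rabs_sin2atan_sqr_lt_1; lra). reflexivity.
  - assert (Hprim := is_primitive_harm_cot (p :: w) (Forall_cons _ Hp Hw)).
    destruct p as [|[|k]]; [lia| |].
    + apply (polylog_fun_int_tan (S (weight w)) true (fun t => 2 * harm_cot w t));
        [now apply polylog_fun_double|].
      eapply is_primitive_ext; [|exact Hprim]. intros t Ht. cbn [harm_source].
      change (PSeries (harm_coef w 1) (sin2atan t ^ 2)) with (harm_gen w 1 t).
      rewrite harm_gen_1 by lra. ring.
    + replace (S (weight (S (S k) :: w))) with (S (S k + S (weight w)))
        by (simpl; lia).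
      apply (polylog_fun_int_dtheta _ false (fun t => 2 * harm_gen w (S (S k)) t));
        [now apply polylog_fun_double, polylog_fun_harm_gen|exact Hprim].
Qed.

(** * Integration against [dtheta / sin theta] *)

(* The integral of [sin^(2m+1)] from [0] to [2 atan t], by Wallis' recursion. *)
Fixpoint sin_odd_int (m : nat) (t : R) : R :=
  match m with
  | O => 1 - cos2atan t
  | S p => / (2 * INR m + 1)
      * (2 * INR m * sin_odd_int p t - (sin2atan t ^ 2) ^ m * cos2atan t)
  end.

Lemma is_derive_sin_odd_int (m : nat) (t : R) :
  is_derive (sin_odd_int m) t (dtheta t * sin2atan t * (sin2atan t ^ 2) ^ m).
Proof.
  induction m as [|m IH].
  - evar_last.
    + apply (is_derive_minus (V := R_NormedModule));
        [apply is_derive_const|apply is_derive_cos2atan].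
    + unfold minus, plus, opp, zero; simpl. ring.
  - evar_last.
    + apply is_derive_scal, (is_derive_minus (V := R_NormedModule)).
      * apply is_derive_scal, IH.
      * apply (is_derive_mult (fun t => (sin2atan t ^ 2) ^ S m) cos2atan);
          [|apply is_derive_cos2atan|exact Rmult_comm].
        do 2 apply is_derive_pow. apply is_derive_sin2atan.
    + unfold minus, plus, opp, scal, mult; cbn -[INR pow].
      unfold mult; cbn -[INR pow].
      pose proof (pos_INR (S m)). pose proof (sin2_cos2_2atan t) as Hsc.
      rewrite <- (tech_pow_Rmult _ m). set (u := (sin2atan t ^ 2) ^ m).
      transitivity (/ (2 * INR (S m) + 1) * (dtheta t * sin2atan t * u
        * (2 * INR (S m) * (1 - cos2atan t ^ 2) + sin2atan t ^ 2)));
        [simpl (INR 2); ring|].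
      replace (1 - cos2atan t ^ 2) with (sin2atan t ^ 2) by lra. field. lra.
Qed.

Lemma sin_odd_int_0 (m : nat) : sin_odd_int m 0 = 0.
Proof.
  assert (Hcos : cos2atan 0 = 1) by (unfold cos2atan; field).
  induction m as [|m IH]; cbn [sin_odd_int]; [lra|].
  rewrite IH, sin2atan_0, !pow_i by lia. ring.
Qed.

Lemma sin_odd_int_1 (m : nat) :
  sin_odd_int m 1 = / (2 * INR (S m) * binom_ratio (S m)).
Proof.
  assert (Hcos : cos2atan 1 = 0) by (unfold cos2atan; field).
  induction m as [|m IH]; cbn [sin_odd_int]; rewrite Hcos.
  - rewrite binom_ratio_S, binom_ratio_0. simpl; field.
  - rewrite IH, (binom_ratio_S (S m)), (S_INR (S m)).
    pose proof (INR_S_ge_1 m). pose proof (binom_ratio_pos (S m)).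
    field. repeat split; lra.
Qed.

Lemma sin_odd_int_incr (m : nat) (t r : R) :
  0 <= t <= r -> r <= 1 -> 0 <= sin_odd_int m t <= sin_odd_int m r.
Proof.
  intros Ht Hr.
  assert (Hmono : forall x y, 0 <= x <= y -> y <= 1 ->
    sin_odd_int m x <= sin_odd_int m y).
  { intros x y Hxy Hy. eapply le_of_derive_nonneg;
      [lra|intros z _; apply is_derive_sin_odd_int|].
    intros z Hz. cbv beta. apply Rmult_le_pos; [apply Rmult_le_pos|].
    - apply dtheta_bounds.
    - apply (sin2atan_incr z z); lra.
    - apply pow_le, pow2_ge_0. }
  split; [rewrite <- (sin_odd_int_0 m)|]; apply Hmono; lra.
Qed.

Lemma is_derive_sum_sin_odd_int (u : nat -> R) (N : nat) (t : R) :
  is_derive (fun t => sum_n (fun m => u m * sin_odd_int m t) N) t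
    (dtheta t * sin2atan t * sum_n (fun m => u m * (sin2atan t ^ 2) ^ m) N).
Proof.
  evar_last.
  - apply (is_derive_sum_n (V := R_NormedModule)). intros m _.
    apply is_derive_scal, is_derive_sin_odd_int.
  - rewrite <- (sum_n_mult_l (K := R_Ring)). apply sum_n_ext.
    intros m. unfold mult; simpl. ring.
Qed.

(* For [r < 1] the power series in [sin^2 theta] converges uniformly on [[0, r]]. *)
Lemma is_series_sin_odd_int (u : nat -> R) (F : R -> R) (r : R) :
  (forall m, 0 <= u m) -> Rbar_le 1 (CV_radius u) ->
  is_primitive F (fun t => dtheta t * sin2atan t * PSeries u (sin2atan t ^ 2)) ->
  0 <= r < 1 -> is_series (fun m => u m * sin_odd_int m r) (F r).
Proof.
  intros Hu Hrad (HF0 & HFc & HFd) Hr.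
  set (psum := fun x N => sum_n (fun m => u m * x ^ m) N).
  set (y := sin2atan r ^ 2).
  assert (Hy : 0 <= y < 1) by (split; [apply pow2_ge_0|now apply sin2atan_sqr_lt_1]).
  apply (is_lim_seq_of_derive
    (fun N t => sum_n (fun m => u m * sin_odd_int m t) N)
    (fun N t => dtheta t * sin2atan t * psum (sin2atan t ^ 2) N) F
    (fun t => dtheta t * sin2atan t * PSeries u (sin2atan t ^ 2))
    (fun N => 2 * (PSeries u y - psum y N)) 0 r).
  - lra.
  - intros N. rewrite HF0, (sum_n_ext _ (fun _ => 0)), sum_n_const; [ring|].
    intros m. rewrite sin_odd_int_0. apply Rmult_0_r.
  - intros N t _. eapply is_derive_continuity_pt, is_derive_sum_sin_odd_int.
  - intros t Ht. apply HFc. lra.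
  - intros N t _. apply is_derive_sum_sin_odd_int.
  - intros t Ht. apply HFd. lra.
  - intros N t Ht. destruct (sin2atan_incr t r) as [Hsin Hincr]; [lra..|].
    assert (Htail : 0 <= PSeries u (sin2atan t ^ 2) - psum (sin2atan t ^ 2) N
      <= PSeries u y - psum y N).
    { apply PSeries_tail_le; [exact Hu|now apply Rbar_lt_le_trans with 1|].
      split; [apply pow2_ge_0|apply pow_incr; lra]. }
    pose proof (dtheta_bounds t). pose proof (sin2atan_sqr_lt_1 t ltac:(lra)).
    assert (Hfactor : 0 <= dtheta t * sin2atan t <= 2) by nra.
    rewrite <- Rmult_minus_distr_l, Rabs_mult, Rabs_minus_sym.
    rewrite (Rabs_pos_eq (dtheta t * _)), (Rabs_pos_eq (_ - _)) by lra.
    apply Rmult_le_compat; lra.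
  - replace (Finite 0) with (Rbar_mult 2 0) by (simpl; f_equal; ring).
    apply is_lim_seq_scal_l, is_lim_seq_PSeries_tail, Rabs_lt_CV_radius;
      [exact Hrad|rewrite Rabs_pos_eq; lra].
Qed.

Lemma term_sin_odd_int (w : list nat) (s m : nat) :
  term w (S s) (S m) = 2 * harm_coef w s (S m) * sin_odd_int m 1.
Proof.
  rewrite sin_odd_int_1. unfold term. cbn [harm_coef].
  replace (S m - 1)%nat with m by lia. fold (binom_ratio (S m)).
  pose proof (INR_S_ge_1 m). pose proof (binom_ratio_pos (S m)).
  rewrite <- (tech_pow_Rmult _ s). field.
  repeat split; try lra. apply pow_nonzero; lra.
Qed.

(* [dtheta / sin theta = dt / t] *)
Lemma is_series_term_of_primitive (w : list nat) (s : nat) (F : R -> R) (l : R) :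
  word_ok w ->
  is_primitive F (fun t => 2 * harm_gen w (S s) t / t) ->
  filterlim F (at_left 1) (locally l) ->
  is_series (fun m => term w (S (S s)) (S m)) l.
Proof.
  intros Hw HF Hl. set (u := PS_scal 2 (PS_decr_1 (harm_coef w (S s)))).
  assert (Hu : forall m, 0 <= u m).
  { intros m. apply Rmult_le_pos; [lra|apply harm_coef_nonneg]. }
  assert (Hrad : Rbar_le 1 (CV_radius u)).
  { unfold u. rewrite CV_radius_scal by lra.
    rewrite <- (CV_radius_ext _ _ (PS_derive_harm_coef w (S s))), CV_radius_derive.
    apply harm_coef_radius; [exact Hw|lia]. }
  assert (HF' : is_primitive F
    (fun t => dtheta t * sin2atan t * PSeries u (sin2atan t ^ 2))).
  { eapply is_primitive_ext; [|exact HF]. intros t Ht. unfold u, harm_gen.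
    rewrite PSeries_scal, <- PSeries_decr_1_harm_coef.
    unfold sin2atan, dtheta. field. split; nra. }
  apply (is_series_ext (fun m => u m * sin_odd_int m 1)).
  { intros m. symmetry. apply term_sin_odd_int. }
  apply (is_series_at_left (fun m t => u m * sin_odd_int m t) F 0 1 l);
    [lra| | | |exact Hl].
  - intros m r Hr. destruct (sin_odd_int_incr m r 1) as [Hint Hincr]; [lra..|].
    specialize (Hu m). nra.
  - intros m. apply (ex_derive_continuous (V := R_NormedModule)).
    eexists. apply is_derive_scal, is_derive_sin_odd_int.
  - intros r Hr. apply is_series_sin_odd_int; auto. lra.
Qed.

Theorem theorem4p15 (w : list nat) (s : nat) :
  word_ok w -> (3 <= s)%nat ->
  exists l : R,
    is_series (fun k => term w s (S k)) l /\
    in_CMZV 4 (s + weight w) (RtoC l).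
Proof.
  intros Hw Hs. destruct s as [|[|[|k]]]; [lia..|].
  assert (Hgen : polylog_fun 4 (S (k + S (weight w))) false (harm_gen w (S (S k))))
    by now apply polylog_fun_harm_gen, polylog_fun_harm_cot.
  apply polylog_fun_double in Hgen.
  destruct (polylog_fun_int_dlog_in_CMZV 4 (Nat.lt_0_succ 3) _ _ Hgen)
    as (F & l & HF & Hl & HC).
  exists l. split; [now apply is_series_term_of_primitive with F|].
  now replace (S (S (S k)) + weight w)%nat with (S (S (k + S (weight w)))) by lia.
Qed.
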